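(* Let $G$ be a graph and let $d$ be the maximum average degree of a minor of $G$. Then for every ball hypergraph $\mathcal{H}$ of $G$, $\nu^*(\mathcal{H})\le \mathrm{e}\,d\cdot \nu(\mathcal{H})$. In particular, if $G$ is planar then $\nu^*(\mathcal{H})\le 6\mathrm{e}\cdot\nu(\mathcal{H})$, and there is an absolute constant $c>0$ such that if $G$ has no $K_t$-minor then $\nu^*(\mathcal{H})\le c\cdot t\sqrt{\log t}\cdot \nu(\mathcal{H})$.
   Context: Graphs are finite; $\mathrm{e}$ is the base of the natural logarithm. The average degree of a graph $(V,E)$ is $2|E|/|V|$. A hypergraph $\mathcal{H}=(V,\mathcal{E})$ has vertex set $V$ and edge set $\mathcal{E}\subseteq 2^V$. A matching is a set of pairwise vertex-disjoint edges; $\nu(\mathcal{H})$ is the maximum number of edges in a matching. The fractional matching number $\nu^*(\mathcal{H})$ is the maximum of $\sum_{e\in\mathcal{E}} w_e$ over all $w_e\ge 0$ satisfying $\sum_{e\ni v} w_e\le 1$ for every vertex $v$. For a graph $G$, an integer $r\ge 0$ and a vertex $v$, $B_r(v)=\{u\in V(G): d_G(u,v)\le r\}$, with $d_G$ the shortest-path distance. A ball hypergraph of $G$ is a hypergraph with vertex set $V(G)$ each of whose edges is a ball $B_r(v)$ for some integer $r\ge 0$ and vertex $v$.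
   Formalization: The first inequality is stated for graphs G with at least one edge; it fails for edgeless G, e.g. a single vertex v with H = {B_0(v)}, where d = 0 but ν* = ν = 1. *)

(* Defs.v *)
From HB Require Import structures.
From mathcomp Require Import all_boot all_order all_algebra.
From mathcomp Require Import all_classical all_reals all_analysis.
Import Order.TTheory GRing.Theory Num.Theory.
Import numFieldNormedType.Exports.

Set Implicit Arguments.
Unset Strict Implicit.
Unset Printing Implicit Defensive.

Local Open Scope ring_scope.

Record sgraph := SGraph {
  vertex :> finType;
  adj : rel vertex;
  adj_sym : symmetric adj;
  adj_irrefl : irreflexive adj }.

Definition edges (G : sgraph) : {set {set G}} :=
  [set A : {set G} | [exists x, exists y, adj x y && (A == [set x; y])]]%SET.

(* For the graph without vertices this is 0 / 0 = 0. *)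
Definition avg_degree (R : realType) (G : sgraph) : R :=
  (2 * #|edges G|)%N%:R / #|G|%:R.

Definition connected_in (G : sgraph) (S : {set G}) : Prop :=
  S != finset.set0 /\
  {in S &, forall x y, connect [rel a b | [&& a \in S, b \in S & adj a b]] x y}.

(* [phi x] is the branch set that is contracted to the vertex [x] of [M]. *)
Definition minor (M G : sgraph) : Prop :=
  exists phi : M -> {set G},
    [/\ forall x, connected_in (phi x),
        forall x y, x != y -> [disjoint phi x & phi y] &
        forall x y, adj x y ->
          exists u v, [/\ u \in phi x, v \in phi y & adj u v]].

(* A maximum: a minor of [G] has at most #|G| vertices, so the set is finite,
   and it contains the average degree of [G] itself. *)
Definition max_minor_avg_degree (R : realType) (G : sgraph) : R :=
  sup [set x : R | exists M : sgraph, minor M G /\ x = avg_degree R M]%classic.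

Definition complete_rel (t : nat) : rel 'I_t := [rel x y | x != y].

Lemma complete_sym (t : nat) : symmetric (@complete_rel t).
Proof. by move=> x y; rewrite /complete_rel /= eq_sym. Qed.

Lemma complete_irrefl (t : nat) : irreflexive (@complete_rel t).
Proof. by move=> x; rewrite /complete_rel /= eqxx. Qed.

Definition complete (t : nat) : sgraph :=
  SGraph (@complete_sym t) (@complete_irrefl t).

(* Topological planarity: the vertices are distinct points, the edges are arcs
   joining their two ends, and the interior of an arc meets neither a vertex
   nor the interior of another arc. *)
Definition planar (R : realType) (G : sgraph) : Prop :=
  exists (pos : G -> R * R) (arc : {set G} -> R -> R * R),
    [/\ injective pos,
        (forall A, A \in edges G ->
          [/\ {within `[0, 1], continuous (arc A)}%classic,
              {in `[0, 1] &, injective (arc A)},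
              exists x y : G,
                [/\ A = [set x; y]%SET, arc A 0 = pos x & arc A 1 = pos y] &
              forall s, 0 < s < 1 -> forall z, arc A s <> pos z]) &
        {in edges G &, forall A B, A != B ->
          forall s t, 0 < s < 1 -> 0 < t < 1 -> arc A s <> arc B t}].

Definition walk (G : sgraph) (n : nat) (u v : G) : bool :=
  [exists p : n.-tuple G, path (@adj G) u p && (last u p == v)].

(* The least length of a walk from [u] to [v]. It is meaningful only if [u] and
   [v] are connected: otherwise the distance is infinite, but this is #|G|. *)
Definition gdist (G : sgraph) (u v : G) : nat :=
  find (fun n => walk n u v) (iota 0 #|G|).

Definition ball (G : sgraph) (r : nat) (v : G) : {set G} :=
  [set u : G | connect (@adj G) u v && (gdist u v <= r)%N]%SET.

Definition ball_hypergraph (G : sgraph) (H : {set {set G}}) : Prop :=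
  forall A, A \in H -> exists (r : nat) (v : G), A = ball r v.

Definition matching_number (T : finType) (H : {set {set T}}) : nat :=
  \max_(M : {set {set T}} | (M \subset H) && finset.trivIset M) #|M|.

Definition fractional_matching (R : realType) (T : finType)
    (H : {set {set T}}) (w : {set T} -> R) : Prop :=
  {in H, forall A, 0 <= w A} /\
  forall v : T, \sum_(A in H | v \in A) w A <= 1.

(* If no edge of [H] is empty, as in a ball hypergraph, then the weights are
   bounded by 1, and the supremum is a maximum by compactness. *)
Definition fractional_matching_number (R : realType) (T : finType)
    (H : {set {set T}}) : R :=
  sup [set x : R | exists w : {set T} -> R,
         fractional_matching H w /\ x = \sum_(A in H) w A]%classic.

(* Main.v *)
(* Weight the balls by an optimal fractional matching w, pass to inclusion-minimal
balls, and sample each ball A independently with probability 1 - exp(- w A). Pairs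
of sampled balls with a common vertex that lies in no other sampled ball are the
edges of a minor of G, whose branch sets are additively weighted Voronoi cells, so
there are at most d/2 of them per sampled ball. In expectation this bounds, for
u = exp w - 1, the sum of u A * u B over intersecting pairs by e d * sum of u; hence
some ball meets balls of total u-weight at most e d, and a greedy choice gives a
matching of size at least (sum of u) / (e d).

A planar graph has no K_5 minor: for paths with disjoint images, the parities of the
numbers of path segments below the ends of the other path are related, and summing
the relation over the fifteen pairs of disjoint edges of K_5 gives 0 = 1. A
minor-minimal graph with 3n - 1 edges has all its edges in three triangles and a
vertex of degree at most five, whose neighbourhood has a K_4 minor; so the minors of
a planar graph have average degree at most 6.

For the last bound, a minor-minimal graph with b n edges has a vertex whose
neighbourhood is a graph on at most 2 b vertices with minimum degree at least b.
After passing to a part of it that is robustly connected with small diameter, one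
selects the branch sets of a K_t minor greedily: a random set of C sqrt(log t)
vertices touches all the previous branch sets, and short paths make it connected. *)
Require Import Defs.
From mathcomp Require Import all_boot all_order all_algebra.
From mathcomp Require Import all_classical all_reals all_analysis.
From mathcomp Require Import zify ring lra.
Import Order.TTheory GRing.Theory Num.Theory.
Import numFieldNormedType.Exports.
From mathcomp Require Import fintype finset.

Set Implicit Arguments.
Unset Strict Implicit.
Unset Printing Implicit Defensive.

(** * Minors and degrees *)

Lemma connect_ind (T : finType) (e : rel T) (P : T -> Prop) (a b : T) :
  P a -> (forall x y, P x -> e x y -> P y) -> connect e a b -> P b.
Proof.
move=> Pa Pe /connectP[p]; elim: p a Pa => [|x p IH] a Pa /=; first by move=> _ ->.
by case/andP=> ax px; apply: IH px; apply: Pe Pa ax.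
Qed.

Lemma adj_neq (G : sgraph) (x y : G) : adj x y -> x != y.
Proof. by apply: contraTneq => ->; rewrite adj_irrefl. Qed.

(** Convertible to the relation inside [connected_in], so that hypotheses of that form apply to it
    directly. *)
Definition in_adj (G : sgraph) (S : {set G}) : rel G :=
  [rel a b | [&& a \in S, b \in S & adj a b]].

Lemma in_adj_sym (G : sgraph) (S : {set G}) : connect_sym (in_adj S).
Proof. by apply: sym_connect_sym => x y; rewrite /in_adj /= adj_sym andbCA. Qed.

Lemma connect_in_adjW (G : sgraph) (S T : {set G}) x y :
  S \subset T -> connect (in_adj S) x y -> connect (in_adj T) x y.
Proof.
move=> /subsetP ST; apply: connect_sub => a b /and3P[aS bS ab].
by apply: connect1; rewrite /in_adj /= !ST.
Qed.

Lemma connected_in_root (G : sgraph) (S : {set G}) r :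
  r \in S -> (forall x, x \in S -> connect (in_adj S) r x) -> connected_in S.
Proof.
move=> rS rx; split; first by apply/set0Pn; exists r.
by move=> x y xS yS; apply: connect_trans (rx _ yS); rewrite in_adj_sym rx.
Qed.

Lemma connected_in1 (G : sgraph) (x : G) : connected_in [set x].
Proof.
by apply: (connected_in_root (set11 x)) => y /set1P->; exact: connect0.
Qed.

Lemma connected_inU (G : sgraph) (S T : {set G}) (x : G) :
  x \in S -> x \in T -> connected_in S -> connected_in T -> connected_in (S :|: T).
Proof.
move=> xS xT [_ cS] [_ cT]; apply: (@connected_in_root _ _ x); first by rewrite inE xS.
move=> y /setUP[yS|yT].
  exact: connect_in_adjW (subsetUl S T) (cS _ _ xS yS).
exact: connect_in_adjW (subsetUr S T) (cT _ _ xT yT).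
Qed.

Lemma connected_in2 (G : sgraph) (x y : G) : adj x y -> connected_in [set x; y].
Proof.
move=> xy; apply: (@connected_in_root _ _ x); first by rewrite !inE eqxx.
move=> z /set2P[->|->]; first exact: connect0.
by apply: connect1; rewrite /in_adj /= !inE !eqxx orbT.
Qed.

Lemma connected_in_edge (G : sgraph) (S T : {set G}) (x y : G) :
  x \in S -> y \in T -> adj x y -> connected_in S -> connected_in T ->
  connected_in (S :|: T).
Proof.
move=> xS yT xy cS cT; have cxy := connected_in2 xy.
have cSx : connected_in (S :|: [set x; y]).
  by apply: (@connected_inU _ _ _ x) => //; rewrite !inE eqxx.
suff -> : S :|: T = (S :|: [set x; y]) :|: T.
  by apply: (@connected_inU _ _ _ y) => //; rewrite !inE eqxx !orbT.
apply/setP => z; rewrite !inE.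
by case: eqP => [->|_]; [rewrite xS|case: eqP => [->|_]; [rewrite yT !orbT|rewrite !orbF]].
Qed.

Lemma minor_trans (K M G : sgraph) : minor K M -> minor M G -> minor K G.
Proof.
case=> psi [cpsi dpsi epsi] [phi [cphi dphi ephi]].
exists (fun x => \bigcup_(y in psi x) phi y); split=> [x|x y xy|x y xy].
- have [/set0Pn[a aS] ca] := cpsi x.
  have [/set0Pn[u uS] cu] := cphi a.
  apply: (@connected_in_root _ _ u); first by apply/bigcupP; exists a.
  move=> v /bigcupP[b bS vb].
  (* Along a path inside [psi x] the invariant is that the whole branch set of the current vertex is
     reachable from [u]. *)
  suff H : b \in psi x /\ (forall v, v \in phi b ->
      connect (in_adj (\bigcup_(y in psi x) phi y)) u v) by case: H => _; apply.
  apply: (connect_ind (P := fun b => b \in psi x /\ _) _ _ (ca _ _ aS bS)).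
    split=> // w wa; apply: connect_in_adjW (cu _ _ uS wa).
    by apply: bigcup_sup.
  move=> c c' [cx IH] /and3P[_ c'x cc']; split=> // w wc'.
  have [p [q [pc qc' pq]]] := ephi _ _ cc'.
  apply: (connect_trans (IH _ pc)); apply: (@connect_trans _ _ q).
    apply: connect1; rewrite /in_adj /= pq andbT.
    by apply/andP; split; apply/bigcupP; [exists c|exists c'].
  have [_ /(_ _ _ qc' wc')] := cphi c'; apply: connect_in_adjW.
  exact: bigcup_sup.
- rewrite -setI_eq0; apply/eqP/setP => v; rewrite !inE; apply/negP.
  case/andP=> /bigcupP[a ax va] /bigcupP[b bY vb].
  have [ab|nab] := eqVneq a b.
    by move: (dpsi _ _ xy) => /pred0P/(_ a) /=; rewrite ax ab bY.
  by move: (dphi _ _ nab) => /pred0P/(_ v) /=; rewrite va vb.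
- have [a [b [ax bY ab]]] := epsi _ _ xy.
  have [u [v [ua vb uv]]] := ephi _ _ ab.
  by exists u, v; split=> //; apply/bigcupP; [exists a|exists b].
Qed.

Lemma minor_inj (M G : sgraph) (f : M -> G) :
  injective f -> (forall x y, adj x y -> adj (f x) (f y)) -> minor M G.
Proof.
move=> fi fa; exists (fun x => [set f x]); split=> [x|x y xy|x y xy].
- exact: connected_in1.
- by rewrite disjoints1 inE (inj_eq fi).
- by exists (f x), (f y); split; rewrite ?inE //; apply: fa.
Qed.

Lemma minor_refl (G : sgraph) : minor G G.
Proof. exact: (minor_inj (f := id)). Qed.

Section Induced.
Variables (G : sgraph) (S : {set G}).

Definition induced_rel : rel {x : G | x \in S} := relpre val (@adj G).

Lemma induced_sym : symmetric induced_rel.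
Proof. by move=> x y; rewrite /induced_rel /= adj_sym. Qed.

Lemma induced_irrefl : irreflexive induced_rel.
Proof. by move=> x; rewrite /induced_rel /= adj_irrefl. Qed.

Definition induced := SGraph induced_sym induced_irrefl.

Lemma minor_induced : minor induced G.
Proof. exact: (minor_inj (f := fun x : induced => val x)) val_inj _. Qed.

Lemma card_induced : #|induced| = #|S|.
Proof. by rewrite card_sig; apply: eq_card => x; rewrite inE. Qed.

End Induced.

Definition nbr (G : sgraph) (x : G) : {set G} := [set y | adj x y].

Lemma in_nbr (G : sgraph) (x y : G) : (y \in nbr x) = adj x y.
Proof. by rewrite inE. Qed.

Definition degsum (G : sgraph) : nat := \sum_(x : G) #|nbr x|.

Lemma card_nbr_induced (G : sgraph) (S : {set G}) (x : induced S) :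
  #|nbr x| = #|nbr (val x) :&: S|.
Proof.
rewrite -(card_imset _ val_inj); apply: eq_card => y; apply/imsetP/idP.
  by case=> z; rewrite !inE => xz ->; rewrite (valP z) andbT.
by rewrite !inE => /andP[xy yS]; exists (exist _ y yS); rewrite ?inE.
Qed.

(** Double counting of incidences: sending [y] to [[set x; y]] is a bijection from the neighbours of
    [x] to the edges containing [x]. *)
Lemma degsumE (G : sgraph) : degsum G = (2 * #|edges G|)%N.
Proof.
have nbrE (x : G) : #|nbr x| = \sum_(A in edges G | x \in A) 1%N.
  have <- : #|[set [set x; y] | y in nbr x]| = #|nbr x|.
    rewrite card_in_imset // => y z yx zx /setP/(_ y).
    rewrite !inE eqxx orbT => /esym/orP[|]/eqP // yx'.
    by move: yx; rewrite yx' inE adj_irrefl.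
  rewrite sum1dep_card; apply: eq_card => A; rewrite !inE; apply/imsetP/andP.
    case=> y; rewrite inE => xy ->; rewrite !inE eqxx; split=> //.
    by apply/existsP; exists x; apply/existsP; exists y; rewrite xy /=.
  case=> /existsP[a /existsP[b /andP[ab /eqP->]]]; rewrite !inE => /orP[]/eqP->.
    by exists b; rewrite ?inE.
  by exists a; rewrite ?inE 1?adj_sym // setUC.
rewrite /degsum (eq_bigr _ (fun x _ => nbrE x)) (exchange_big_dep (mem (edges G))) /=.
  rewrite mulnC -sum_nat_const; apply: eq_bigr => A Ae.
  rewrite (eq_bigl (fun x => x \in A)) => [|x]; last by rewrite Ae.
  move: Ae; rewrite sum1_card inE => /existsP[a /existsP[b /andP[ab /eqP->]]].
  by rewrite cards2 (adj_neq ab).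
by move=> x A _ /andP[].
Qed.

(** * Parity of disjoint polygons *)

Section Parity.
Variable R : realType.
Local Open Scope ring_scope.
Implicit Types a b c d z p q : R * R.

Definition lexlt p q : bool := (p.1 < q.1) || ((p.1 == q.1) && (p.2 < q.2)).

Lemma lexltP p q : reflect (p.1 < q.1 \/ p.1 = q.1 /\ p.2 < q.2) (lexlt p q).
Proof.
apply: (iffP orP) => -[]; [by left|by case/andP => /eqP; right|by left|].
by case=> -> ->; right; rewrite eqxx.
Qed.

Lemma lexlt_trans p q z : lexlt p q -> lexlt q z -> lexlt p z.
Proof. by move=> /lexltP ? /lexltP ?; apply/lexltP; lra. Qed.

Lemma lexlt_asym p q : lexlt p q -> lexlt q p = false.
Proof. by move=> /lexltP ?; apply/negbTE/negP => /lexltP ?; lra. Qed.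

Lemma lexltxx p : lexlt p p = false.
Proof. by apply/negbTE/negP => /lexltP ?; lra. Qed.

Lemma lexlt_total p q : [\/ p = q, lexlt p q | lexlt q p].
Proof.
have [pq|pq|pq] := ltrgtP p.1 q.1.
- by constructor 2; apply/lexltP; left.
- by constructor 3; apply/lexltP; left.
have [pq'|pq'|pq'] := ltrgtP p.2 q.2.
- by constructor 2; apply/lexltP; right.
- by constructor 3; apply/lexltP; right.
by constructor 1; case: p q pq pq' => [? ?] [? ?] /= -> ->.
Qed.

Definition seg a b (t : R) : R * R :=
  (a.1 + t * (b.1 - a.1), a.2 + t * (b.2 - a.2)).

(** Twice the signed area of the triangle [a], [b], [z]. If [a] is to the left of [b], it is
    negative exactly when [z] lies below the line through them. *)
Definition orient a b z : R :=
  (b.1 - a.1) * (z.2 - a.2) - (b.2 - a.2) * (z.1 - a.1).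

(* The upward ray from [z] meets the segment from [a] to [b]. Ties between abscissas
   are broken by ordinates, as if the plane were sheared infinitesimally, so that no
   general position is needed. *)
Definition below z a b : bool :=
  [&& lexlt a z, lexlt z b & orient a b z < 0] ||
  [&& lexlt b z, lexlt z a & orient b a z < 0].

Lemma belowC z a b : below z a b = below z b a.
Proof. by rewrite /below orbC. Qed.

Lemma below_lt z a b : lexlt a b ->
  below z a b = [&& lexlt a z, lexlt z b & orient a b z < 0].
Proof.
move=> ab; rewrite /below.
case bz: (lexlt b z); case za: (lexlt z a); rewrite ?andbF ?orbF //=.
by have := lexlt_trans bz za; rewrite lexlt_asym.
Qed.

Lemma belowxx z a : below z a a = false.
Proof.
rewrite /below orbb; case az: (lexlt a z); case za: (lexlt z a) => //=.
by have := lexlt_trans az za; rewrite lexltxx.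
Qed.

Definition seg_disjoint a b c d :=
  forall s t, 0 <= s <= 1 -> 0 <= t <= 1 -> seg a b s <> seg c d t.

(** The parameter is a ratio of abscissas, or of ordinates if the segment is vertical. *)
Lemma on_seg a b z : lexlt a z -> lexlt z b -> orient a b z = 0 ->
  exists2 s, 0 <= s <= 1 & z = seg a b s.
Proof.
move=> /lexltP az /lexltP zb; rewrite /orient => o.
have [ab|ab] := ltrP a.1 b.1.
  have d0 : 0 < b.1 - a.1 by lra.
  exists ((z.1 - a.1) / (b.1 - a.1)).
    by rewrite divr_ge0 ?ler_pdivrMr ?mul1r //=; lra.
  rewrite /seg; apply: injective_projections => /=.
    by field; lra.
  have -> : z.2 = a.2 + (b.2 - a.2) * (z.1 - a.1) / (b.1 - a.1).
    have -> : (b.2 - a.2) * (z.1 - a.1) = (b.1 - a.1) * (z.2 - a.2) by lra.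
    by field; lra.
  by field; lra.
have [e1 [e2 [h1 h2]]] : b.1 = a.1 /\ z.1 = a.1 /\ a.2 < z.2 /\ z.2 < b.2 by lra.
exists ((z.2 - a.2) / (b.2 - a.2)).
  by rewrite divr_ge0 ?ler_pdivrMr ?mul1r //=; lra.
rewrite /seg; apply: injective_projections => /=; first by rewrite e1 e2; ring.
by field; lra.
Qed.

Lemma seg_lex_between c d t : lexlt c d -> 0 < t < 1 ->
  lexlt c (seg c d t) /\ lexlt (seg c d t) d.
Proof.
move=> /lexltP[cd|[cd cd']] t01; split; apply/lexltP; rewrite /seg /=.
- by left; nra.
- by left; nra.
- by right; split; [rewrite cd; ring|nra].
- by right; split; [rewrite cd; ring|nra].
Qed.

Lemma seg_disjointC a b c d : seg_disjoint a b c d -> seg_disjoint c d a b.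
Proof. by move=> D s t hs ht /esym; apply: D. Qed.

Lemma segC a b t : seg a b t = seg b a (1 - t).
Proof. by rewrite /seg; apply: injective_projections => /=; ring. Qed.

Lemma seg_disjointCl a b c d : seg_disjoint a b c d -> seg_disjoint b a c d.
Proof. by move=> D s t hs ht; rewrite segC; apply: D => //; lra. Qed.

Lemma seg0 a b : seg a b 0 = a.
Proof. by rewrite /seg; apply: injective_projections => /=; ring. Qed.

Lemma seg1 a b : seg a b 1 = b.
Proof. by rewrite /seg; apply: injective_projections => /=; ring. Qed.

Lemma orient_seg a b c d t :
  orient a b (seg c d t) = (1 - t) * orient a b c + t * orient a b d.
Proof. by rewrite /orient /seg /=; ring. Qed.

(** The quotient is the zero of the affine function with value [x] at 0 and [y] at 1. It serves as
    the parameter at which a segment crosses a line. *)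
Lemma div_sub01 (x y : R) : x * y < 0 -> 0 < x / (x - y) < 1 /\ x - y != 0.
Proof.
wlog x0 : x y / 0 < x => [H xy|xy].
  have [x0|x0|x0] := ltrgtP 0 x; first exact: H.
    have [||h n] := H (- x) (- y); [by lra|by rewrite mulrNN|].
    have -> : x / (x - y) = - x / (- x - - y) by field; lra.
    by split=> //; lra.
  by move: xy; rewrite -x0 mul0r ltxx.
have y0 : y < 0 by nra.
have d0 : 0 < x - y by lra.
by rewrite divr_gt0 // ltr_pdivrMr // mul1r lt0r_neq0 //; split=> //; lra.
Qed.

(** If [c] and [d] are not strictly on one side of the line through [a] and [b], the segment from
    [c] to [d] meets that line. The meeting point is lexicographically between [a] and [b], hence on
    their segment. *)
Lemma nested_contra a b c d :
  lexlt a c -> lexlt c d -> lexlt d b -> seg_disjoint a b c d ->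
  orient a b c * orient a b d <= 0 -> False.
Proof.
move=> ac cd db D o.
have cb := lexlt_trans cd db; have ad := lexlt_trans ac cd.
have I01 : 0 <= (0 : R) <= 1 /\ 0 <= (1 : R) <= 1 by lra.
have [e1|/eqP e1] := eqVneq (orient a b c) 0.
  have [s hs es] := on_seg ac cb e1.
  by apply: (D s 0) => //; rewrite ?seg0 //; case: I01.
have [e2|/eqP e2] := eqVneq (orient a b d) 0.
  have [s hs es] := on_seg ad db e2.
  by apply: (D s 1) => //; rewrite ?seg1 //; case: I01.
set t := orient a b c / (orient a b c - orient a b d).
have [t01 n0] : 0 < t < 1 /\ orient a b c - orient a b d != 0.
  by apply: div_sub01; rewrite lt_neqAle o mulf_neq0 //; apply/eqP.
have [h1 h2] := seg_lex_between cd t01.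
have ez : orient a b (seg c d t) = 0.
  by rewrite orient_seg /t; field.
have [s hs es] := on_seg (lexlt_trans ac h1) (lexlt_trans h2 db) ez.
by apply: (D s t) => //; lra.
Qed.

Lemma cross_contra a b c d : seg_disjoint a b c d ->
  orient a b c * orient a b d < 0 -> orient c d a * orient c d b < 0 -> False.
Proof.
move=> D o1 o2.
have [h1 n1] := div_sub01 o1; have [h2 n2] := div_sub01 o2.
apply: (D (orient c d a / (orient c d a - orient c d b))
          (orient a b c / (orient a b c - orient a b d))); [lra|lra|].
move: n1 n2; rewrite /seg /orient => n1 n2.
by apply: injective_projections => /=; field; apply/andP; split.
Qed.

(** If [c] is below the segment from [a] to [b] and [b] is below the segment from [c] to [d], the
    vertical order of the two segments changes between [c] and [b], so they cross. The same holds
    with above in both places. *)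
Lemma interleaved_contra a b c d :
  lexlt a c -> lexlt c b -> lexlt b d -> seg_disjoint a b c d ->
  (orient c d b < 0) = (orient a b c < 0) -> False.
Proof.
move=> ac cb bd D E.
have I01 : 0 <= (0 : R) <= 1 /\ 0 <= (1 : R) <= 1 by lra.
have [e1|/eqP n1] := eqVneq (orient a b c) 0.
  have [s hs es] := on_seg ac cb e1.
  by apply: (D s 0) => //; rewrite ?seg0 //; case: I01.
have [e2|/eqP n2] := eqVneq (orient c d b) 0.
  have [s hs es] := on_seg cb bd e2.
  by apply: (D 1 s) => //; rewrite ?seg1 //; case: I01.
(* [X] and [Y] express the two remaining orientations by the two given ones; equal signs of the
   latter determine the signs of the former. *)
have X : (b.1 - c.1) * orient a b d =
   - orient c d b * (b.1 - a.1) - orient a b c * (d.1 - b.1).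
  by rewrite /orient; ring.
have Y : (b.1 - c.1) * orient c d a =
   - orient a b c * (d.1 - c.1) - orient c d b * (c.1 - a.1).
  by rewrite /orient; ring.
have [/lexltP ac' [/lexltP cb' /lexltP bd']] := (ac, (cb, bd)).
(* If [b] and [c] have the same abscissa, the two orientations have weakly opposite signs, which
   contradicts [E]. *)
have [bc|bc] := ltrP c.1 b.1; last first.
  have cb1 : c.1 = b.1 by lra.
  have o1 : orient a b c = - ((b.1 - a.1) * (b.2 - c.2)).
    by rewrite /orient cb1; ring.
  have o2 : orient c d b = (d.1 - c.1) * (b.2 - c.2).
    by rewrite /orient cb1; ring.
  have cb2 : 0 <= b.2 - c.2 by lra.
  have h1 : orient a b c <= 0 by rewrite o1 oppr_le0 mulr_ge0 //; lra.
  have h2 : 0 <= orient c d b by rewrite o2 mulr_ge0 //; lra.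
  move: E; have -> : orient a b c < 0 by lra.
  by move/idP; lra.
have bc0 : 0 < b.1 - c.1 by lra.
have ba0 : 0 < b.1 - a.1 by lra.
have db0 : 0 <= d.1 - b.1 by lra.
have dc0 : 0 < d.1 - c.1 by lra.
have ca0 : 0 <= c.1 - a.1 by lra.
clear ac' cb' bd' bc.
have sgn (u v w x y z : R) : 0 < u -> 0 < v -> 0 <= w -> u * x = - y * v - z * w ->
    y * z > 0 -> x * z < 0.
  move=> u0 v0 w0 e yz; suff : (u * x) * z < 0.
    by rewrite -mulrA pmulr_rlt0.
  have -> : (u * x) * z = - (y * z * v + z * z * w) by rewrite e; ring.
  rewrite oppr_lt0; apply: ltr_wpDr; last exact: mulr_gt0.
  by rewrite mulr_ge0 // -expr2 sqr_ge0.
have yz : orient c d b * orient a b c > 0.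
  have [h1|h1] := ltrP (orient a b c) 0.
    by rewrite nmulr_rgt0 // E.
  have h2 : 0 <= orient c d b by rewrite leNgt E ltNge h1.
  by rewrite mulr_gt0 // lt_neqAle eq_sym ?h1 ?h2 andbT; apply/eqP.
apply: (cross_contra D).
  by rewrite mulrC; apply: sgn bc0 ba0 db0 X yz.
by apply: sgn bc0 dc0 ca0 Y _; rewrite mulrC.
Qed.

Definition seg_parity_stmt a b c d :=
  below a c d (+) below b c d (+) below c a b (+) below d a b =
  lexlt a c (+) lexlt b c (+) lexlt a d (+) lexlt b d.

Lemma seg_disjoint_neq a b c d : seg_disjoint a b c d ->
  [/\ a <> c, a <> d, b <> c & b <> d].
Proof.
move=> D; have h0 : 0 <= (0 : R) <= 1 by lra.
have h1 : 0 <= (1 : R) <= 1 by lra.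
by split=> e; [move: (D 0 0)|move: (D 0 1)|move: (D 1 0)|move: (D 1 1)];
   rewrite ?seg0 ?seg1; apply.
Qed.

Lemma lexlt_neg a b : a <> b -> lexlt b a = ~~ lexlt a b.
Proof.
case: (lexlt_total a b) => // h _; last by rewrite (lexlt_asym h) h.
by rewrite (lexlt_asym h) h.
Qed.

(** By symmetry [a] is the least point and [c] precedes [d]. If [b] precedes [c], no point is below
    the other segment; the interleaved and the nested orders are the two lemmas above. *)
Lemma seg_parity a b c d : seg_disjoint a b c d -> seg_parity_stmt a b c d.
Proof.
wlog ab : a b / lexlt a b.
  move=> H D; case: (lexlt_total a b) => [<-|/H|/H]; last 2 first.
  - exact.
  - move/(_ (seg_disjointCl D)); rewrite /seg_parity_stmt.
    rewrite (belowC c) (belowC d).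
    rewrite (addbC (below b _ _)) (addbC (lexlt b _)) -!addbA.
    by rewrite (addbC (lexlt b d)).
  rewrite /seg_parity_stmt !belowxx.
  by case: (below a c d) (lexlt a c) (lexlt a d) => [] [] [].
wlog cd : c d / lexlt c d.
  move=> H D; case: (lexlt_total c d) => [<-|/H|/H]; last 2 first.
  - exact.
  - move/(_ (seg_disjointC (seg_disjointCl (seg_disjointC D)))).
    rewrite /seg_parity_stmt (belowC a) (belowC b).
    by case: (below c a b) (below d a b) (lexlt a c) (lexlt b c) (lexlt a d)
             (lexlt b d) (below a c d) (below b c d) => [] [] [] [] [] [] [] [].
  rewrite /seg_parity_stmt !belowxx.
  by case: (below c a b) (lexlt a c) (lexlt b c) => [] [] [].
wlog ac : a b c d ab cd / lexlt a c.
  move=> H D; have [nac nad nbc nbd] := seg_disjoint_neq D.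
  case: (lexlt_total a c) => // h; first exact: H.
  have := H _ _ _ _ cd ab h (seg_disjointC D).
  rewrite /seg_parity_stmt (lexlt_neg nac) (lexlt_neg nad) (lexlt_neg nbc) (lexlt_neg nbd).
  by case: (below c a b) (below d a b) (lexlt a c) (lexlt b c) (lexlt a d)
             (lexlt b d) (below a c d) (below b c d) => [] [] [] [] [] [] [] [].
move=> D; have [nac nad nbc nbd] := seg_disjoint_neq D.
have ad := lexlt_trans ac cd.
rewrite /seg_parity_stmt !below_lt // ac ad (lexlt_asym ac) (lexlt_neg nbc) (lexlt_neg nbd) /=.
case bc: (lexlt b c) => /=.
  by rewrite (lexlt_trans bc cd).
have cb : lexlt c b by rewrite (lexlt_neg nbc) bc.
case bd: (lexlt b d) => /=.
  have := interleaved_contra ac cb bd D.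
  by case: (orient c d b < 0); case: (orient a b c < 0) => // /(_ erefl).
have db : lexlt d b by rewrite (lexlt_neg nbd) bd.
have N := nested_contra ac cd db D.
case: (ltP (orient a b c) 0) => h1; case: (ltP (orient a b d) 0) => h2 //.
  by case: N; rewrite nmulr_rle0.
by case: N; rewrite nmulr_lle0.
Qed.

Fixpoint poly_below z p (s : seq (R * R)) : bool :=
  if s is q :: s' then below z p q (+) poly_below z q s' else false.

Fixpoint poly_inside (X : set (R * R)) p (s : seq (R * R)) : Prop :=
  if s is q :: s' then (forall t, 0 <= t <= 1 -> X (seg p q t)) /\ poly_inside X q s'
  else True.

Lemma poly_inside_cat X p s1 s2 :
  poly_inside X p s1 -> poly_inside X (last p s1) s2 -> poly_inside X p (s1 ++ s2).
Proof. by elim: s1 p => //= q s IH p [h1 h2] h3; split=> //; apply: IH. Qed.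

Lemma poly_inside_sub (X Y : set (R * R)) p s :
  (forall z, X z -> Y z) -> poly_inside X p s -> poly_inside Y p s.
Proof.
by move=> XY; elim: s p => //= q s IH p [h1 h2]; split=> [t ht|]; [apply/XY/h1|apply: IH].
Qed.

(** This is the sum of [seg_parity_stmt] over all pairs of segments. Terms at inner vertices occur
    twice and cancel, so that only the four ends remain. *)
Lemma poly_parity (X Y : set (R * R)) p s q t :
  (forall z, X z -> Y z -> False) -> poly_inside X p s -> poly_inside Y q t ->
  let side x := poly_below x q t (+) lexlt x q (+) lexlt x (last q t) in
  side p (+) side (last p s) = poly_below q p s (+) poly_below (last q t) p s.
Proof.
have concat (u v w k l m n : bool) : u (+) v = k (+) l -> v (+) w = m (+) n ->
    u (+) w = (k (+) m) (+) (l (+) n).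
  by move: u v w k l m n; do 7! case.
have concat' (u v u' v' k l m : bool) : u (+) v = k (+) l -> u' (+) v' = l (+) m ->
    (u (+) u') (+) (v (+) v') = k (+) m.
  by move: u v u' v' k l m; do 7! case.
move=> XY + hY /=; elim: s p => [|p1 s IHs] p /=; first by rewrite !addbb.
case=> hX /IHs.
suff : poly_below p q t (+) lexlt p q (+) lexlt p (last q t) (+)
   (poly_below p1 q t (+) lexlt p1 q (+) lexlt p1 (last q t)) =
   below q p p1 (+) below (last q t) p p1.
  exact: concat.
clear IHs; elim: t q hY => [|q1 t IHt] q /=; first by rewrite !addbb.
case=> hY /IHt {IHt}.
have : seg_parity_stmt p p1 q q1.
  apply: seg_parity => r r' hr hr' e.
  by apply: (XY (seg p p1 r)); [exact: hX|rewrite e; exact: hY].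
rewrite /seg_parity_stmt.
have split4 (x y z v w : bool) : x (+) y (+) z (+) w = (x (+) z (+) v) (+) (y (+) v (+) w).
  by case: x y z v w => [] [] [] [] [].
have regroup (x y z v k l m n : bool) : x (+) y (+) z (+) v = k (+) l (+) m (+) n ->
   x (+) k (+) m (+) (y (+) l (+) n) = z (+) v.
  by move: x y z v k l m n; do 8! case.
move/regroup => h1 h2.
rewrite (split4 (below p q q1) (poly_below p q1 t) _ (lexlt p q1))
  (split4 (below p1 q q1) (poly_below p1 q1 t) _ (lexlt p1 q1)).
exact: concat' h1 h2.
Qed.
End Parity.

(** * Arcs and polygons *)

Section UnitInterval.
Variable R : realType.
Local Open Scope ring_scope.
Implicit Types (p q z : R * R) (f g : R -> R * R).

(** Real induction: [E] spreads from a point just left of the supremum of its range to a point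
    beyond it, unless the range already reaches 1. *)
Lemma unit_interval_ind (E : R -> Prop) :
  E 0 ->
  (forall c, 0 <= c <= 1 -> exists2 d, 0 < d &
    forall e x, 0 <= e <= c -> c - d < e -> E e -> c <= x <= 1 -> x < c + d -> E x) ->
  E 1.
Proof.
move=> E0 step; pose S : set R := fun x => 0 <= x <= 1 /\ E x.
have S0 : S 0 by split=> //; lra.
have ubS : has_sup S.
  by split; [exists 0|exists 1 => x [/andP[]]].
have c0 : 0 <= sup S by apply: ub_le_sup; [case: ubS|].
have c1 : sup S <= 1 by apply: ge_sup; [exists 0|move=> x [/andP[]]].
have [d d0 hd] := step (sup S) ltac:(lra).
have [e [e01 Ee] ce] := sup_adherent d0 ubS.
have ec : e <= sup S by apply: ub_le_sup; [case: ubS|].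
have [h|h] := lerP 1 (sup S + d / 2).
  by apply: (hd e 1) => //; lra.
have Sx : S (sup S + d / 2).
  by split; [lra|apply: (hd e _) => //; lra].
have : sup S + d / 2 <= sup S by apply: ub_le_sup; [case: ubS|].
by lra.
Qed.

(** Compactness of the unit interval: positive constants that work locally, and may be decreased,
    can be replaced by a single one. *)
Lemma unit_interval_uniform (Q : R -> R -> Prop) :
  (forall e e' t, 0 < e' <= e -> Q e t -> Q e' t) ->
  (forall c, 0 <= c <= 1 -> exists d e, [/\ 0 < d, 0 < e &
    forall t, 0 <= t <= 1 -> c - d < t < c + d -> Q e t]) ->
  exists2 e, 0 < e & forall t, 0 <= t <= 1 -> Q e t.
Proof.
move=> mono loc.
pose E (u : R) := exists2 e, 0 < e & forall t, 0 <= t <= 1 -> t <= u -> Q e t.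
suff [e e0 he] : E 1 by exists e => // t ht; apply: he => //; lra.
apply: unit_interval_ind.
  have [d [e [d0 e0 he]]] := loc 0 ltac:(lra).
  by exists e => // t ht t0; apply: he => //; lra.
move=> c hc; have [d [e [d0 e0 he]]] := loc c hc.
exists d => // u x hu cu [e' e'0 he'] hx xd.
have m0 : 0 < Order.min e e' by rewrite lt_min e0.
exists (Order.min e e') => // t ht tx.
have [tu|ut] := lerP t u.
  by apply: (mono e'); rewrite ?m0 ?ge_min ?lexx ?orbT //; apply: he'.
by apply: (mono e); rewrite ?m0 ?ge_min ?lexx ?orbT //; apply: he => //; lra.
Qed.

(** An open square in the sup norm, written as linear inequalities that [lra] can use. *)
Definition near2 p q (e : R) : Prop :=
  (- e < p.1 - q.1 < e) /\ (- e < p.2 - q.2 < e).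

Definition unit_continuous f := forall t e, 0 <= t <= 1 -> 0 < e ->
  exists2 d, 0 < d & forall s, 0 <= s <= 1 -> t - d < s < t + d -> near2 (f t) (f s) e.

Lemma within_unit_continuous f :
  {within `[0, 1]%classic, continuous f}%classic -> unit_continuous f.
Proof.
move=> /subspace_continuousP cf t e t01 e0.
have /(_ t) := cf; rewrite /= in_itv /= => /(_ t01).
move=> /cvg_ballP /(_ e e0); rewrite near_withinE => /nbhs_ballP[d /= d0 hd].
exists d => // s s01 sd.
have [] : ball (f t) e (f s).
  by apply: hd; rewrite /ball /= ?in_itv //= ltr_norml; lra.
by rewrite /ball /= !ltr_norml; split.
Qed.

(** Compactness is used twice: first to separate one point from the arc [g], then to make this
    distance uniform along [f]. *)
Lemma unit_continuous_sep f g : unit_continuous f -> unit_continuous g ->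
  (forall s t, 0 <= s <= 1 -> 0 <= t <= 1 -> f s <> g t) ->
  exists2 e, 0 < e & forall s t, 0 <= s <= 1 -> 0 <= t <= 1 -> ~ near2 (f s) (g t) e.
Proof.
move=> cf cg fg.
have far p q : p <> q -> exists2 e, 0 < e & ~ near2 p q e.
  move=> pq; have [e1|n1] := eqVneq p.1 q.1; last first.
    exists `|p.1 - q.1|; first by rewrite normr_gt0 subr_eq0.
    by case; rewrite -ltr_norml ltxx.
  have [e2|n2] := eqVneq p.2 q.2.
    by case: pq; exact: injective_projections.
  exists `|p.2 - q.2|; first by rewrite normr_gt0 subr_eq0.
  by case => _; rewrite -ltr_norml ltxx.
have near2W p q (e e' : R) : 0 < e' <= e -> ~ near2 p q e -> ~ near2 p q e'.
  by move=> ee' n [h1 h2]; apply: n; split; lra.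
have sepg p : (forall t, 0 <= t <= 1 -> p <> g t) ->
    exists2 e, 0 < e & forall t, 0 <= t <= 1 -> ~ near2 p (g t) e.
  move=> pg; apply: unit_interval_uniform => [e e' t|c hc]; first exact: near2W.
  have [e e0 pe] := far _ _ (pg c hc).
  have [d d0 hd] := cg c (e / 2) hc ltac:(lra).
  exists d, (e / 2); split => //; first lra.
  move=> t ht td [h1 h2]; apply: pe.
  by have [h3 h4] := hd t ht td; split; lra.
have [] := @unit_interval_uniform (fun e s => forall t, 0 <= t <= 1 -> ~ near2 (f s) (g t) e).
- by move=> e e' s ee' h t ht; apply: near2W ee' (h t ht).
- move=> c hc; have [e e0 pe] := sepg (f c) (fun t ht => fg c t hc ht).
  have [d d0 hd] := cf c (e / 2) hc ltac:(lra).
  exists d, (e / 2); split => //; first lra.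
  move=> s hs sd t ht [h1 h2]; apply: (pe t ht).
  by have [h3 h4] := hd s hs sd; split; lra.
by move=> e e0 he; exists e => // s t hs ht; apply: he.
Qed.

Definition arc_nbhd f (e : R) : set (R * R) :=
  fun z => exists2 t, 0 <= t <= 1 & near2 z (f t) e.

Lemma near2_seg c p q e t : near2 c p e -> near2 c q e -> 0 <= t <= 1 ->
  near2 (seg p q t) c e.
Proof.
have conv (x y u : R) : - e < u - x < e -> - e < u - y < e -> 0 <= t <= 1 ->
    - e < x + t * (y - x) - u < e.
  move=> h1 h2 ht; have [t1|t1] := eqVneq t 1; first by rewrite t1; lra.
  have t1' : t < 1 by rewrite lt_neqAle t1; lra.
  have p1 : 0 < (1 - t) * (e - (u - x)) by apply: mulr_gt0; lra.
  have p2 : 0 < (1 - t) * (e + (u - x)) by apply: mulr_gt0; lra.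
  have p3 : 0 <= t * (e - (u - y)) by apply: mulr_ge0; lra.
  have p4 : 0 <= t * (e + (u - y)) by apply: mulr_ge0; lra.
  lra.
by move=> [h1 h2] [h3 h4] ht; split; apply: conv.
Qed.

(** Nearby points of the arc lie in a common square, which contains the chord between them. Both
    directions are built because an edge may be traversed from either end of its arc. *)
Lemma arc_polygon f e : unit_continuous f -> 0 < e ->
  (exists2 s, last (f 0) s = f 1 & poly_inside (arc_nbhd f e) (f 0) s) /\
  (exists2 s, last (f 1) s = f 0 & poly_inside (arc_nbhd f e) (f 1) s).
Proof.
move=> cf e0; apply: (@unit_interval_ind (fun u =>
  (exists2 s, last (f 0) s = f u & poly_inside (arc_nbhd f e) (f 0) s) /\
  (exists2 s, last (f u) s = f 0 & poly_inside (arc_nbhd f e) (f u) s))).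
  by split; exists [::].
move=> c hc; have [d d0 hd] := cf c e hc e0.
exists d => // u x hu cu [[s1 l1 i1] [s2 l2 i2]] hx xd.
have nu := hd u ltac:(lra) ltac:(lra).
have nx := hd x ltac:(lra) ltac:(lra).
split.
  exists (rcons s1 (f x)); first by rewrite last_rcons.
  rewrite -cats1; apply: poly_inside_cat => //=; split=> // t ht.
  by rewrite l1; exists c => //; apply: near2_seg.
exists (f u :: s2) => //=; split=> // t ht.
by exists c => //; apply: near2_seg.
Qed.
End UnitInterval.

(** * Planar graphs have no K5 minor *)

Section K5Parity.

Definition xor_list (T : eqType) (env : T -> bool) (s : seq T) : bool :=
  foldr (fun a b => env a (+) b) false s.

Lemma xor_list_cat (T : eqType) (env : T -> bool) s t :
  xor_list env (s ++ t) = xor_list env s (+) xor_list env t.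
Proof. by elim: s => //= a s ->; rewrite addbA. Qed.

Lemma xor_list_even (T : eqType) (env : T -> bool) s :
  all (fun a => ~~ odd (count_mem a s)) s -> xor_list env s = false.
Proof.
have -> : xor_list env s = \big[addb/false]_(a <- s) env a.
  by elim: s => [|a s IH] /=; rewrite ?big_nil ?big_cons ?IH.
move=> /allP ev; rewrite -big_undup_iterop_count big1_seq // => a /andP[_].
rewrite mem_undup => /ev; move: (count_mem a s) => n.
have iterE k : iterop k.+1 addb (env a) false = odd k.+1 && env a.
  by elim: k => //= k ->; case: (odd k) (env a) => [] [].
by case: n => // n; rewrite iterE => /negbTE->.
Qed.

(** The disjoint pairs of edges of K_5; the condition [i < k] lists each unordered pair once. *)
Definition disjoint_pairs : seq (nat * nat * nat * nat) :=
  let pairs := [seq ij <- [seq (i, j) | i <- iota 0 5, j <- iota 0 5] | ij.1 < ij.2] in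
  [seq q <- [seq (ij, kl.1, kl.2) | ij <- pairs, kl <- pairs]
   | let: (i, j, k, l) := q in [&& i < k, j != k & j != l]].

(* (i, k, l) encodes U i k l, (i, j, 5) encodes L i j, and (5, 5, 5) encodes true. *)
Definition lex_code (i j : nat) : seq (nat * nat * nat) :=
  if i < j then [:: (i, j, 5)] else [:: (j, i, 5); (5, 5, 5)].

Definition pair_code (q : nat * nat * nat * nat) : seq (nat * nat * nat) :=
  let: (i, j, k, l) := q in
  [:: (i, k, l); (j, k, l); (k, i, j); (l, i, j)] ++
  lex_code i k ++ lex_code i l ++ lex_code j k ++ lex_code j l.

(* Every U i k l occurs in exactly two of the fifteen equations, while the three
   equations on four given indices contain in total three pairs of opposite values
   of L. *)
Lemma K5_parity (U : nat -> nat -> nat -> bool) (L : rel nat) :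
  (forall i j, i < j < 5 -> L j i = ~~ L i j) ->
  (forall i j k l, [&& i < j < 5, k < l < 5, i != k, i != l, j != k & j != l] ->
    (U i k l (+) L i k (+) L i l) (+) (U j k l (+) L j k (+) L j l) =
    U k i j (+) U l i j) -> False.
Proof.
move=> Lneg Heq.
pose env (a : nat * nat * nat) := let: (i, k, l) := a in
  if l == 5 then (if i == 5 then true else L i k) else U i k l.
suff E : xor_list env (flatten (map pair_code disjoint_pairs)) = false.
  (* Computation checks that every code occurs evenly often once one more constant is put in front.
     That constant has value true, which contradicts [E]. *)
  have := @xor_list_even _ env ([:: (5, 5, 5)] ++ flatten (map pair_code disjoint_pairs)) isT.
  by rewrite xor_list_cat E.
have lexE i j : i < 5 -> j < 5 -> i != j -> xor_list env (lex_code i j) = L i j.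
  move=> i5 j5 ij; rewrite /lex_code; case: ltnP => h /=.
    by rewrite (ltn_eqF i5) addbF.
  rewrite (ltn_eqF j5) (Lneg j i) ?negbK //; first by case: (L j i).
  by rewrite ltn_neqAle eq_sym ij h.
have : all (fun q : nat * nat * nat * nat => let: (i, j, k, l) := q in
   [&& i < j < 5, k < l < 5, i != k, i != l, j != k & j != l]) disjoint_pairs by [].
elim: disjoint_pairs => //= -[[[i j] k] l] s IH /andP[hq /IH hs].
have /and5P[/andP[ij j5] /andP[kl l5] ik il /andP[jk jl]] := hq.
have i5 := ltn_trans ij j5; have k5 := ltn_trans kl l5.
rewrite !xor_list_cat hs !lexE //= (ltn_eqF l5) (ltn_eqF j5).
have := Heq i j k l hq.
by move: (U i k l) (U j k l) (U k i j) (U l i j) (L i k) (L i l) (L j k) (L j l); do 8! case.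
Qed.
End K5Parity.

Section Planar.
Variables (R : realType) (G : sgraph).
Local Open Scope ring_scope.

Lemma finite_uniform (I : finType) (Q : I -> R -> Prop) :
  (forall i e e', 0 < e' <= e -> Q i e -> Q i e') ->
  (forall i, exists2 e, 0 < e & Q i e) ->
  exists2 e, 0 < e & forall i, Q i e.
Proof.
move=> mono ex.
suff [e e0 he] : exists2 e, 0 < e & forall i, i \in enum I -> Q i e.
  by exists e => // i; apply: he; rewrite mem_enum.
elim: (enum I) => [|i s [e e0 he]]; first by exists 1.
have [e' e'0 hi] := ex i.
have m0 : 0 < Order.min e e' by rewrite lt_min e0.
exists (Order.min e e') => // j; rewrite inE => /orP[/eqP->|js].
  by apply: mono hi; rewrite m0 ge_min lexx orbT.
by apply: mono (he j js); rewrite m0 ge_min lexx.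
Qed.

Variables (pos : G -> R * R) (arc : {set G} -> R -> R * R).
Hypothesis pos_inj : injective pos.
Hypothesis arcP : forall A, A \in edges G ->
  [/\ {within `[0, 1], continuous (arc A)}%classic,
      {in `[0, 1] &, injective (arc A)},
      exists x y : G,
        [/\ A = [set x; y]%SET, arc A 0 = pos x & arc A 1 = pos y] &
      forall s, 0 < s < 1 -> forall z, arc A s <> pos z].
Hypothesis arc_cross : {in edges G &, forall A B, A != B ->
  forall s t, 0 < s < 1 -> 0 < t < 1 -> arc A s <> arc B t}.

Lemma arc_disjoint A B : A \in edges G -> B \in edges G -> [disjoint A & B] ->
  forall s t, 0 <= s <= 1 -> 0 <= t <= 1 -> arc A s <> arc B t.
Proof.
move=> Ae Be dAB.
have [_ _ [x [y [Axy A0 A1]]] Ai] := arcP Ae.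
have [_ _ [z [w [Bzw B0 B1]]] Bi] := arcP Be.
have ends C u v s : arc C 0 = pos u -> arc C 1 = pos v -> C = [set u; v] ->
    0 <= s <= 1 -> 0 < s < 1 \/ exists2 p, p \in C & arc C s = pos p.
  move=> C0 C1 eC hs; have [->|s0] := eqVneq s 0.
    by right; exists u => //; rewrite eC !inE eqxx.
  have [->|s1] := eqVneq s 1; first by right; exists v => //; rewrite eC !inE eqxx orbT.
  by left; rewrite !lt_neqAle eq_sym s0 s1.
move=> s t /(ends _ _ _ _ A0 A1 Axy)[hs|[p pA ->]] /(ends _ _ _ _ B0 B1 Bzw)[ht|[q qB ->]].
- apply: arc_cross => //; apply: contraTneq dAB => ->.
  by apply/negP => /pred0P/(_ z); rewrite /= Bzw !inE eqxx.
- exact: Ai.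
- by move/esym; apply: Bi.
- move/pos_inj => pq; move: dAB => /pred0P/(_ p); rewrite /= pA pq qB //.
Qed.

Definition region (S : {set G}) (e : R) : set (R * R) :=
  fun z => exists2 A, (A \in edges G) && (A \subset S) & arc_nbhd (arc A) e z.

Lemma region_disjoint : exists2 e, 0 < e & forall S T : {set G}, [disjoint S & T] ->
  forall z, region S e z -> region T e z -> False.
Proof.
(* A point within [e] of two arcs brings them within [e * 2] of each other. *)
have [] := @finite_uniform ({set G} * {set G})%type (fun AB e =>
   AB.1 \in edges G -> AB.2 \in edges G -> [disjoint AB.1 & AB.2] ->
   forall s t, 0 <= s <= 1 -> 0 <= t <= 1 -> ~ near2 (arc AB.1 s) (arc AB.2 t) (e * 2)).
- move=> AB e e' ee' h Ae Be dAB s t hs ht [h1 h2]; apply: (h Ae Be dAB s t hs ht).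
  by split; lra.
- move=> [A B] /=; have [/and3P[Ae Be dAB]|n] :=
    boolP [&& A \in edges G, B \in edges G & [disjoint A & B]]; last first.
    by exists 1 => // Ae Be dAB; move: n; rewrite Ae Be dAB.
  have [cA _ _ _] := arcP Ae; have [cB _ _ _] := arcP Be.
  have [] := unit_continuous_sep (within_unit_continuous cA)
    (within_unit_continuous cB) (arc_disjoint Ae Be dAB).
  move=> e e0 he; exists (e / 2); first lra.
  by move=> _ _ _ s t hs ht; rewrite divfK ?pnatr_eq0 //; apply: he.
move=> e e0 he; exists e => // S T dST z [A /andP[Ae AS] [s hs [h1 h2]]] [B /andP[Be BT] [t ht [h3 h4]]].
apply: (he (A, B) Ae Be _ s t hs ht) => /=; last by split; lra.
by apply: disjointWl AS _; apply: disjointWr BT _.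
Qed.

Lemma region_polygon (S : {set G}) (e : R) u v : 0 < e -> connect (in_adj S) u v ->
  exists2 s, last (pos u) s = pos v & poly_inside (region S e) (pos u) s.
Proof.
move=> e0; apply: (connect_ind (P := fun v => exists2 s, last (pos u) s = pos v &
  poly_inside (region S e) (pos u) s)); first by exists [::].
move=> x y [s1 l1 i1] /and3P[xS yS xy].
have Ae : [set x; y] \in edges G.
  by rewrite inE; apply/existsP; exists x; apply/existsP; exists y; rewrite xy /=.
have AS : [set x; y] \subset S by apply/subsetP => z /set2P[] ->.
have [cA _ [a [b [Aab A0 A1]]] _] := arcP Ae.
suff [s2 l2 i2] : exists2 s, last (pos x) s = pos y &
    poly_inside (arc_nbhd (arc [set x; y]) e) (pos x) s.
  exists (s1 ++ s2); first by rewrite last_cat l1.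
  apply: poly_inside_cat => //; rewrite l1; apply: poly_inside_sub i2 => z.
  by exists [set x; y] => //; rewrite Ae.
have [[s l i] [s' l' i']] := arc_polygon (within_unit_continuous cA) e0.
move: l i l' i'; rewrite A0 A1 => l i l' i'.
have xab : x \in [set a; b] by rewrite -Aab !inE eqxx.
have yab : y \in [set a; b] by rewrite -Aab !inE eqxx orbT.
have := adj_neq xy.
case/set2P: xab l i l' i' => ->; case/set2P: yab => -> l i l' i'; rewrite ?eqxx // => _.
- by exists s.
- by exists s'.
Qed.

(** A representative is chosen in each branch set, and a polygon near the arcs inside two branch
    sets joins their representatives. For disjoint pairs of indices the polygons lie in disjoint
    regions, so [poly_parity] supplies the equations of [K5_parity]. *)
Lemma no_K5_minor_of_arcs : ~ minor (complete 5) G.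
Proof.
case=> phi [cphi dphi ephi].
have [e e0 he] := region_disjoint.
have /all_sig[r hr] : forall x, {u | u \in phi x}.
  by move=> x; apply: cid; have [/set0Pn[u ux] _] := cphi x; exists u.
have cU x y : x != y -> connected_in (phi x :|: phi y).
  move=> xy; have [u [v [ux vy uv]]] := ephi x y xy.
  exact: connected_in_edge ux vy uv (cphi x) (cphi y).
have /all_sig[P hP] : forall xy : 'I_5 * 'I_5, {s | xy.1 != xy.2 ->
    last (pos (r xy.1)) s = pos (r xy.2) /\
    poly_inside (region (phi xy.1 :|: phi xy.2) e) (pos (r xy.1)) s}.
  move=> [x y]; apply: cid => /=; have [xy|xy] := eqVneq x y; first by exists [::].
  have [_ c] := cU x y xy.
  have [s l i] := region_polygon e0 (c _ _ (subsetP (subsetUl _ _) _ (hr x))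
    (subsetP (subsetUr _ _) _ (hr y))).
  by exists s.
pose v i := pos (r (inord i)).
pose U i k l := poly_below (v i) (v k) (P (inord k, inord l)).
apply: (@K5_parity U (fun i j => lexlt (v i) (v j))).
  move=> i j /andP[ij j5]; apply: lexlt_neg => /pos_inj rij.
  have ne : (inord i : 'I_5) != inord j.
    by rewrite -val_eqE /= !inordK ?(ltn_eqF ij) // (ltn_trans ij).
  by move: (dphi _ _ ne) => /pred0P/(_ (r (inord i))) /=; rewrite hr rij hr.
move=> i j k l /and5P[/andP[ij j5] /andP[kl l5] ik il /andP[jk jl]].
have i5 := ltn_trans ij j5; have k5 := ltn_trans kl l5.
have neE a b : (a < 5)%N -> (b < 5)%N -> a != b -> (inord a : 'I_5) != inord b.
  by move=> a5 b5; rewrite -val_eqE /= !inordK.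
have [l1 i1] := hP (inord i, inord j) (neE _ _ i5 j5 (negbT (ltn_eqF ij))).
have [l2 i2] := hP (inord k, inord l) (neE _ _ k5 l5 (negbT (ltn_eqF kl))).
have dS : [disjoint phi (inord i) :|: phi (inord j) & phi (inord k) :|: phi (inord l)].
  by rewrite -setI_eq0 setIUl !setIUr !setU_eq0 !setI_eq0 !dphi // neE.
have := poly_parity (he _ _ dS) i1 i2.
by rewrite /= l1 l2.
Qed.

End Planar.

Lemma planar_no_K5_minor (R : realType) (G : sgraph) :
  planar R G -> ~ minor (complete 5) G.
Proof. by case=> pos [arc [pi aP ac]]; exact: no_K5_minor_of_arcs pi aP ac. Qed.

(** * Distances *)

Section Distance.
Variable G : sgraph.
Implicit Types x y z v : G.

Lemma walkP n x y :
  reflect (exists p : seq G, [/\ size p = n, path (@adj G) x p & last x p = y]) (walk n x y).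
Proof.
apply: (iffP existsP) => [[p /andP[pp /eqP lp]]|[p [sp pp lp]]].
  by exists p; rewrite size_tuple.
by exists (tcast sp (in_tuple p)); rewrite val_tcast /= pp lp eqxx.
Qed.

Lemma walk_connect n x y : walk n x y -> connect (@adj G) x y.
Proof. by case/walkP=> p [_ pp lp]; apply/connectP; exists p. Qed.

Lemma gdist_walk x y : connect (@adj G) x y ->
  walk (gdist x y) x y /\ gdist x y < #|G|.
Proof.
case/connectP=> p /shortenP[q qp uq _] ->.
have lt : size q < #|G|.
  by have := card_uniqP uq => /= <-; exact: max_card.
have H : has (fun n => walk n x (last x q)) (iota 0 #|G|).
  by apply/hasP; exists (size q); [rewrite mem_iota|apply/walkP; exists q].
have := nth_find 0 H; rewrite -/(gdist _ _).
have := H; rewrite has_find size_iota -/(gdist _ _) => lt'.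
by rewrite nth_iota.
Qed.

Lemma gdist_le n x y : walk n x y -> gdist x y <= n.
Proof.
move=> w; rewrite leqNgt; apply/negP => lt.
have [_ nG] := gdist_walk (walk_connect w).
by have := before_find 0 lt; rewrite nth_iota ?(ltn_trans lt) // w.
Qed.

Lemma gdistxx x : gdist x x = 0.
Proof. by apply/eqP; rewrite -leqn0; apply: gdist_le; apply/walkP; exists [::]. Qed.

Lemma gdist_adj x y z : adj x y -> connect (@adj G) y z -> gdist x z <= (gdist y z).+1.
Proof.
move=> xy /gdist_walk[/walkP[p [sp pp lp]] _]; apply: gdist_le; apply/walkP.
by exists (y :: p); split; rewrite /= ?sp ?xy.
Qed.

Lemma gdist_step x z n : connect (@adj G) x z -> gdist x z = n.+1 ->
  exists y, [/\ adj x y, connect (@adj G) y z & gdist y z = n].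
Proof.
move=> /gdist_walk[/walkP[[|y p] [//= sp pp lp]] _] e; first by rewrite e in sp.
case/andP: pp => xy pp; have w : walk n y z.
  by apply/walkP; exists p; split=> //; move: sp; rewrite e => -[].
exists y; split=> //; first exact: walk_connect w.
apply/eqP; rewrite eqn_leq gdist_le //= -ltnS -e.
exact: gdist_adj xy (walk_connect w).
Qed.

Lemma gdist0 x z : connect (@adj G) x z -> gdist x z = 0 -> x = z.
Proof. by move=> /gdist_walk[/walkP[[|y p] [sp pp lp]] _] e; rewrite e in sp. Qed.

Lemma gdist_lower x z n : connect (@adj G) x z -> n <= gdist x z ->
  exists2 y, connect (@adj G) y z & gdist y z = n.
Proof.
move=> xz; move eD : (gdist x z) => D; elim: D x xz eD => [|D IH] x xz eD.
  by rewrite leqn0 => /eqP->; exists x.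
rewrite leq_eqVlt => /orP[/eqP->|]; first by exists x.
by have [y [_ yz yD]] := gdist_step xz eD; exact: IH yz yD.
Qed.

Lemma geodesic x z : connect (@adj G) x z ->
  exists Q : {set G}, [/\ #|Q| <= (gdist x z).+1, x \in Q, z \in Q & connected_in Q].
Proof.
move=> xz; move eD : (gdist x z) => D; elim: D x xz eD => [|D IH] x xz eD.
  exists [set x]; rewrite cards1 -(gdist0 xz eD) set11; split=> //.
  exact: connected_in1.
have [y [xy yz yD]] := gdist_step xz eD; have [Q [cQ yQ zQ Qc]] := IH y yz yD.
exists (x |: Q); split; rewrite ?setU11 ?(setU1r _ zQ) //.
  by rewrite cardsU1; case: (x \notin Q); rewrite ?add0n ?add1n // (leq_trans cQ).
exact: connected_in_edge (set11 x) yQ xy (connected_in1 x) Qc.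
Qed.
Lemma gdist_triangle x y z : connect (@adj G) x y -> connect (@adj G) y z ->
  gdist x z <= gdist x y + gdist y z.
Proof.
move=> /gdist_walk[/walkP[p [<- pp lp]] _] /gdist_walk[/walkP[q [<- pq lq]] _].
apply: gdist_le; apply/walkP; exists (p ++ q).
by rewrite size_cat cat_path last_cat pp lp.
Qed.
End Distance.

(** * Minor-minimal dense graphs *)

Lemma connected_in_induced (G : sgraph) (S : {set G}) (T : {set induced S}) :
  connected_in T -> connected_in (val @: T : {set G}).
Proof.
case=> /set0Pn[x xT] c; apply: (@connected_in_root _ _ (val x)); first exact: imset_f.
move=> _ /imsetP[y yT ->].
apply: (connect_ind (P := fun y => connect (in_adj (val @: T : {set G})) (val x) (val y)))
  (c _ _ xT yT); first exact: connect0.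
move=> a b IH /and3P[aT bT ab]; apply: connect_trans IH _; apply: connect1.
by rewrite /in_adj /= !imset_f.
Qed.

(** The singleton of [x], placed at index [ord0], is adjacent to every branch set found among the
    neighbours of [x]. *)
Lemma minor_cone (t : nat) (G : sgraph) (x : G) :
  minor (complete t) (induced (nbr x)) -> minor (complete t.+1) G.
Proof.
case=> phi [cphi dphi ephi].
pose psi (i : 'I_t.+1) : {set G} :=
  if unlift ord0 i is Some j then val @: phi j else [set x].
have xpsi j y : y \in val @: phi j -> adj x y.
  by case/imsetP=> z _ ->; have := valP z; rewrite inE.
have disj0 j : [disjoint [set x] & val @: phi j].
  by rewrite disjoints1; apply/negP => /xpsi; rewrite adj_irrefl.
exists psi; split=> [i|i j|i j]; rewrite /psi.
- by case: unliftP => [j _|_]; [exact: connected_in_induced|exact: connected_in1].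
- case: unliftP => [i' ->|->]; case: unliftP => [j' ->|->]; rewrite ?eqxx // => ij.
    rewrite -setI_eq0 -imsetI; last by move=> ? ? _ _; exact: val_inj.
    rewrite imset_eq0 setI_eq0; apply: dphi; apply: contra ij => /eqP->.
    exact: eqxx.
  by rewrite disjoint_sym.
case: unliftP => [i' ->|->]; case: unliftP => [j' ->|->] ij.
- have [|u [v [ui vj uv]]] := ephi i' j'.
    by apply: contra ij => /eqP->; exact: eqxx.
  by exists (val u), (val v); split=> //; exact: imset_f.
- have [/set0Pn[u ui] _] := cphi i'; exists (val u), x.
  have vu : val u \in val @: phi i' by exact: imset_f.
  by split; [|rewrite inE|rewrite adj_sym (xpsi i')].
- have [/set0Pn[u uj] _] := cphi j'; exists x, (val u).
  have vu : val u \in val @: phi j' by exact: imset_f.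
  by split; [rewrite inE| |rewrite (xpsi j')].
- by have := adj_neq ij; rewrite eqxx.
Qed.

Lemma degsum_induced (G : sgraph) (S : {set G}) :
  degsum (induced S) = \sum_(x in S) #|nbr x :&: S|.
Proof.
rewrite /degsum (eq_bigr _ (fun x _ => card_nbr_induced x)).
by rewrite (big_sub S (fun x => #|nbr x :&: S|)).
Qed.

(** * Edge deletion, edge contraction and their effect on degree sums *)

Section Contraction.
Variables (G : sgraph) (x y : G).
Hypothesis xy : adj x y.

Definition del_edge_rel : rel G := [rel a b | adj a b && ([set a; b] != [set x; y])].

Lemma del_edge_sym : symmetric del_edge_rel.
Proof. by move=> a b; rewrite /del_edge_rel /= adj_sym setUC. Qed.

Lemma del_edge_irrefl : irreflexive del_edge_rel.
Proof. by move=> a; rewrite /del_edge_rel /= adj_irrefl. Qed.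

Definition del_edge := SGraph del_edge_sym del_edge_irrefl.

Lemma minor_del_edge : minor del_edge G.
Proof. by apply: (minor_inj (f := fun a : del_edge => (a : G))) => // a b /andP[]. Qed.

Lemma edges_del_edge : #|edges G| = #|edges del_edge|.+1.
Proof.
have xyE : [set x; y] \in edges G.
  by rewrite inE; apply/existsP; exists x; apply/existsP; exists y; rewrite xy /=.
rewrite (cardsD1 [set x; y]) xyE; congr (_.+1); apply: eq_card => A.
rewrite !inE; apply/andP/existsP => [[nA /existsP[a /existsP[b /andP[ab /eqP eA]]]]|].
  exists a; apply/existsP; exists b; apply/andP; split; last by rewrite eA.
  by rewrite /adj /= /del_edge_rel /= ab -eA.
case=> a /existsP[b /andP[/andP[ab nab] /eqP eA]]; split; first by rewrite eA.
by apply/existsP; exists a; apply/existsP; exists b; rewrite ab eA /=.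
Qed.

(** Contraction without a quotient type: [x] takes over the neighbours of [y], and [y] is removed
    only afterwards, in [contraction]. *)
Definition merge_rel : rel G := [rel a b | (a != b) &&
  [|| adj a b, (a == x) && adj y b | (b == x) && adj y a]].

Lemma merge_sym : symmetric merge_rel.
Proof.
by move=> a b; rewrite /merge_rel /= eq_sym adj_sym [_ && adj y b || _]orbC.
Qed.

Lemma merge_irrefl : irreflexive merge_rel.
Proof. by move=> a; rewrite /merge_rel /= eqxx. Qed.

Definition merge := SGraph merge_sym merge_irrefl.

Definition contraction := induced (~: [set y] : {set merge}).

Lemma minor_contraction : minor contraction G.
Proof.
pose phi (a : contraction) : {set G} := if val a == x then [set x; y] else [set val a].
have phiI a b : (b \in phi a) = (b == val a) || (val a == x) && (b == y).
  by rewrite /phi; case: eqP => [->|_]; rewrite !inE ?orbF.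
have ny (a : contraction) : val a != y by have := valP a; rewrite !inE.
exists phi; split=> [a|a b ab|a b].
- by rewrite /phi; case: eqP => _; [exact: connected_in2|exact: connected_in1].
- apply/pred0P => z /=; rewrite !phiI.
  apply/negP => /andP[/orP[/eqP->|/andP[/eqP ax /eqP->]]].
    by rewrite (negbTE (ny a)) andbF orbF val_eqE (negbTE ab).
  rewrite eq_sym (negbTE (ny b)) eqxx andbT /= -ax val_eqE => ba.
  by rewrite eq_sym ba in ab.
- case/andP=> ab /or3P[h|/andP[/eqP ax h]|/andP[/eqP bx h]].
  + by exists (val a), (val b); rewrite !phiI !eqxx.
  + by exists y, (val b); rewrite !phiI !eqxx ax eqxx orbT.
  + by exists (val a), y; rewrite !phiI !eqxx bx eqxx orbT; split=> //; rewrite adj_sym.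
Qed.

(** The edges lost are [xy] itself and one for each common neighbour, and each counts twice in the
    degree sum. *)
Lemma degsum_contraction :
  degsum G <= degsum contraction + 2 * #|nbr x :&: nbr y| + 2.
Proof.
have nxy := adj_neq xy; set C := nbr x :&: nbr y.
pose nbr' (a : G) : {set G} := nbr (a : merge) :&: ~: [set y].
have in_nbr' (a b : G) : (b \in nbr' a) = (b != y) && (a != b) &&
    [|| @adj G a b, (a == x) && @adj G y b | (b == x) && @adj G y a].
  by rewrite in_setI in_setC in_set1 andbC -andbA; congr andb; rewrite [LHS](@in_nbr merge).
have degx : #|nbr y| + #|nbr x| <= #|nbr' x| + #|C| + 2.
  rewrite addnC -cardsUI -/C addnAC leq_add2r -(_ : #|[set x; y]| = 2); last first.
    by rewrite cards2 nxy.
  rewrite -cardsUI; apply: (leq_trans _ (leq_addr _ _)); apply: subset_leq_card.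
  apply/subsetP => b; rewrite [X in _ -> is_true X]in_setU in_nbr' !inE eqxx /= (eq_sym x b).
  by case: (b == x) (b == y) (adj x b) (adj y b) => [] [] [] [].
have dega a : a != y -> a != x -> #|nbr a| <= #|nbr' a| + (a \in C).
  move=> ay ax; rewrite (cardsD1 y) addnC !inE -(adj_sym a y) -(adj_sym a x).
  have sub : nbr a :\ y \subset nbr' a.
    apply/subsetP => b; rewrite in_nbr' !inE => /andP[-> ab].
    by rewrite ab (adj_neq ab).
  case ay': (adj a y); last by rewrite andbF !addn0 subset_leq_card.
  case ax': (adj a x); first by rewrite leq_add2r subset_leq_card.
  have cU : #|x |: nbr a :\ y| = #|nbr a :\ y| + true.
    by rewrite cardsU1 !inE ax' andbF addnC.
  rewrite addn0 -cU.
  apply/subset_leq_card; rewrite subUset sub sub1set in_nbr'.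
  by rewrite nxy ax eqxx (adj_sym y a) ay' !orbT.
rewrite degsum_induced /degsum (bigD1 y) //= (bigD1 x) //=.
rewrite [X in _ <= X + _ + _](bigD1 x) /=; last by rewrite !inE.
rewrite addnA; set S1 := \sum_(i | _) _; set S2 := \sum_(i | _) _.
suff : S1 <= S2 + #|C|.
  by move: degx; rewrite -/(nbr' x) ; move: #|C| #|nbr' x|; lia.
rewrite -sum1_card big_mkcond /= (bigID (fun a => (a != y) && (a != x))) /=.
rewrite addnA; apply: leq_trans (leq_addr _ _).
rewrite /S2 (eq_bigl (fun a => (a != y) && (a != x))); last by move=> a; rewrite !inE.
rewrite -big_split /=; apply: leq_sum => a /andP[ay ax].
by have := dega a ay ax; case: (a \in C).
Qed.
End Contraction.

Lemma degsum_del_vertex (G : sgraph) (x : G) :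
  degsum G = degsum (induced (~: [set x])) + 2 * #|nbr x|.
Proof.
rewrite degsum_induced /degsum (bigD1 x) //=.
rewrite [X in _ = X + _](eq_bigl (fun a => a != x)); last by move=> a; rewrite !inE.
suff -> : \sum_(a | a != x) #|nbr a| = \sum_(a | a != x) #|nbr a :&: ~: [set x]| + #|nbr x|.
  by rewrite addnCA mul2n addnn.
rewrite -[X in _ + X]sum1_card [X in _ + X]big_mkcond /= [X in _ + X](bigD1 x) //=.
rewrite in_nbr adj_irrefl add0n.
rewrite -big_split; apply: eq_bigr => a ax /=.
by rewrite (cardsD1 x) setDE !inE (adj_sym x) addnC; case: adj.
Qed.

Lemma card_nbr_lt (G : sgraph) (x : G) : #|nbr x| < #|G|.
Proof.
rewrite -cardsT; apply: proper_card; rewrite properE subsetT.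
by apply/subsetPn; exists x; rewrite ?inE ?adj_irrefl.
Qed.

(* A minor with as few vertices, then edges, as possible subject to the hypotheses. *)
Lemma dense_minor (b c n0 : nat) (G : sgraph) :
  n0.-1 * n0 + 2 * c < 2 * (b * n0) -> n0 <= #|G| -> b * #|G| <= #|edges G| + c ->
  exists M : sgraph, [/\ minor M G, n0 < #|M|, #|edges M| + c = b * #|M|,
    forall x y : M, adj x y -> b <= #|nbr x :&: nbr y| & forall x : M, b < #|nbr x|].
Proof.
move=> small; move: {2}_.+1 (ltnSn #|G|) => N.
elim: N G => // N IHN G; move: {2}_.+1 (ltnSn #|edges G|) => K.
elim: K G => // K IHK G leK leN nG mG.
have compose (M : sgraph) : minor M G -> (exists K : sgraph, [/\ minor K M, n0 < #|K|,
    #|edges K| + c = b * #|K|, forall x y : K, adj x y -> b <= #|nbr x :&: nbr y|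
    & forall x : K, b < #|nbr x|]) -> exists M : sgraph, [/\ minor M G,
    n0 < #|M|, #|edges M| + c = b * #|M|,
    forall x y : M, adj x y -> b <= #|nbr x :&: nbr y| & forall x : M, b < #|nbr x|].
  by move=> MG [L [LM ? ? ? ?]]; exists L; split=> //; apply: minor_trans LM MG.
(* By [small], even a complete graph on [n0] vertices has too few edges, so no reduction falls below
   [n0] vertices. *)
have n0G : n0 < #|G|.
  rewrite ltn_neqAle nG andbT; apply/eqP => e.
  have : degsum G <= n0 * n0.-1.
    rewrite [X in _ <= X * _]e -sum_nat_const; apply: leq_sum => x _.
    by rewrite -ltnS (leq_trans (card_nbr_lt x)) // e leqSpred.
  by rewrite degsumE; move: mG small; rewrite -e; lia.
have [mlt|meq] := ltnP (b * #|G|) (#|edges G| + c).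
  have [A AE|E0] := pickP (mem (edges G)); last first.
    move: mlt; rewrite (eq_card0 E0) => mlt.
    have bn : b * n0 <= b * #|G| by rewrite leq_mul2l nG orbT.
    by exfalso; move: small mlt bn; move: (_.-1 * _) (b * n0) (b * #|G|); lia.
  move: AE => /=; rewrite inE => /existsP[x /existsP[y /andP[xy _]]].
  have := edges_del_edge xy => e.
  apply: (compose (del_edge x y)); first exact: minor_del_edge.
  have nD : #|del_edge x y| = #|G| by [].
  by apply: IHK => //; rewrite ?nD; move: mlt leK; rewrite e; lia.
(* Contracting an edge whose ends have fewer than [b] common neighbours loses at most [b] edges and
   one vertex, so the density condition survives. The same holds below for deleting a vertex of
   degree at most [b]. *)
have [/existsP[x /existsP[y /andP[xy few]]]|many] :=
    boolP [exists x : G, exists y : G, adj x y && (#|nbr x :&: nbr y| < b)].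
  have d := degsum_contraction xy; rewrite !degsumE in d.
  have nC : #|contraction x y| = #|G|.-1 by rewrite card_induced cardsC1.
  apply: (compose (contraction x y)); first exact: minor_contraction.
  by apply: IHN; rewrite nC; move: leN n0G d few mG; lia.
have [/existsP[x few]|many'] := boolP [exists x : G, #|nbr x| <= b].
  have d := degsum_del_vertex x; rewrite !degsumE in d.
  have nC : #|induced (~: [set x])| = #|G|.-1 by rewrite card_induced cardsC1.
  apply: (compose (induced (~: [set x]))); first exact: minor_induced.
  by apply: IHN; rewrite nC; move: leN n0G d few mG; lia.
exists G; split=> //; first exact: minor_refl.
- by apply/eqP; rewrite eqn_leq meq mG.
- move=> x y xy; rewrite leqNgt; apply: contra many => few.
  by apply/existsP; exists x; apply/existsP; exists y; rewrite xy.
- by move=> x; rewrite ltnNge; apply: contra many' => few; apply/existsP; exists x.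
Qed.

Lemma degsum_nbr (G : sgraph) (b : nat) (x : G) :
  (forall y : G, adj x y -> b <= #|nbr x :&: nbr y|) ->
  #|nbr x| * b <= degsum (induced (nbr x)).
Proof.
move=> h; rewrite degsum_induced -sum_nat_const; apply: leq_sum => y.
by rewrite inE setIC => /h.
Qed.

(** * Complete minors of order three, four and five *)

Lemma K3_minor (G : sgraph) : 0 < #|G| -> #|G| <= #|edges G| -> minor (complete 3) G.
Proof.
move=> nG mG; have [||M [MG nM _ tri deg]] := @dense_minor 1 0 1 G _ nG => //.
  by rewrite mul1n addn0.
apply: minor_trans MG.
have [x _] : exists x : M, true by move/card_gt0P: (ltnW nM) => [x]; exists x.
have /card_gt0P[y] := ltnW (deg x); rewrite inE => xy.
have /card_gt0P[z] := tri _ _ xy; rewrite !inE => /andP[xz yz].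
apply: (minor_inj (f := fun i : complete 3 => nth x [:: x; y; z] i)).
  move=> i j /eqP; rewrite nth_uniq ?ltn_ord //; first by move/eqP/val_inj.
  by rewrite /= !inE negb_or (adj_neq xy) (adj_neq xz) (adj_neq yz).
case=> [[|[|[|i]]] hi] [[|[|[|j]]] hj] //= _; rewrite ?xy ?xz ?yz //;
by rewrite adj_sym ?xy ?xz ?yz.
Qed.

(** In the reduced minor each neighbourhood has minimum degree at least two, hence at least as many
    edges as vertices, and [K3_minor] applies inside it. *)
Lemma K4_minor (G : sgraph) :
  1 < #|G| -> 2 * #|G| <= #|edges G| + 2 -> minor (complete 4) G.
Proof.
move=> nG mG; have [//|M [MG nM _ tri deg]] := @dense_minor 2 2 2 G _ nG mG.
apply: minor_trans MG.
have [x _] : exists x : M, true by move/card_gt0P: (ltnW (ltnW nM)) => [x]; exists x.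
apply: (@minor_cone _ _ x); apply: K3_minor; rewrite card_induced.
  exact: ltn_trans (deg x).
by have := degsum_nbr (tri x); rewrite degsumE mulnC leq_mul2l.
Qed.

(** The reduced minor has [3 n - 1] edges, hence a vertex of degree 4 or 5. Its neighbourhood has
    minimum degree at least 3, hence at least 6 or 8 edges respectively, which is exactly what
    [K4_minor] asks for. *)
Lemma K5_minor (G : sgraph) :
  0 < #|G| -> 3 * #|G| <= #|edges G| + 1 -> minor (complete 5) G.
Proof.
move=> nG mG; have [//|M [MG nM mM tri deg]] := @dense_minor 3 1 1 G _ nG mG.
apply: minor_trans MG.
have [x dx] : exists x : M, #|nbr x| <= 5.
  apply/existsP; apply: contraT; rewrite negb_exists => /forallP big.
  have : #|M| * 6 <= degsum M.
    rewrite -sum_nat_const; apply: leq_sum => x _; by have := big x; rewrite -ltnNge.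
  by rewrite degsumE; move: mM; lia.
apply: (@minor_cone _ _ x); apply: K4_minor; rewrite card_induced.
  by apply: ltn_trans (deg x).
by have := degsum_nbr (tri x); rewrite degsumE; have := deg x; lia.
Qed.

(** * Complete minors of dense graphs *)

Lemma card_bigcup_le (I T : finType) (P : {set I}) (F : I -> {set T}) k :
  (forall i, i \in P -> #|F i| <= k) -> #|\bigcup_(i in P) F i| <= #|P| * k.
Proof.
move=> h; rewrite -sum_nat_const.
apply: (@leq_trans (\sum_(i in P) #|F i|)); last exact: leq_sum.
elim/big_rec2: _ => [|i n A _ IH]; first by rewrite cards0.
by apply: leq_trans (leq_card_setU _ _) _; rewrite leq_add2l.
Qed.

(** The set [X] stands for the branch sets already built, which later paths have to avoid. The
    constants are those that [half_dense_linked] attains: distance at most 5 means at most 6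
    vertices. *)
Definition linked (G : sgraph) : Prop := forall X : {set G}, 16 * #|X| <= #|G| ->
  forall u v, u \notin X -> v \notin X ->
  exists Q : {set G}, [/\ #|Q| <= 6, [disjoint Q & X], u \in Q, v \in Q & connected_in Q].

Definition dense_linked (G : sgraph) : Prop :=
  (forall v : G, #|G| <= 3 * #|nbr v|) /\ linked G.

(** A union of short connected sets, all from one fixed vertex of [I] to the others. *)
Lemma linked_connect (G : sgraph) (X I : {set G}) : linked G -> 16 * #|X| <= #|G| ->
  I != set0 -> [disjoint I & X] ->
  exists B : {set G}, [/\ I \subset B, #|B| <= 6 * #|I|, [disjoint B & X] & connected_in B].
Proof.
move=> lG hX /set0Pn[x0 x0I] dI.
have nX x : x \in I -> x \notin X by move=> xI; rewrite (disjointFr dI xI).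
have /all_sig[Q hQ] : forall x, {Q : {set G} | x \in I ->
    [/\ #|Q| <= 6, [disjoint Q & X], x0 \in Q, x \in Q & connected_in Q]}.
  move=> x; apply: cid; have [xI|] := boolP (x \in I); last by exists set0.
  by have [Q hQ] := lG X hX x0 x (nX _ x0I) (nX _ xI); exists Q.
exists (\bigcup_(x in I) Q x); split.
- by apply/subsetP => x xI; apply/bigcupP; exists x => //; case: (hQ x xI).
- by rewrite mulnC; apply: card_bigcup_le => x /hQ[].
- apply/pred0P => z /=; apply/negP => /andP[/bigcupP[x /hQ[_ d _ _ _] zQ] zX].
  by rewrite (disjointFr d zQ) in zX.
- apply: (@connected_in_root _ _ x0).
    by apply/bigcupP; exists x0 => //; case: (hQ _ x0I).
  move=> z /bigcupP[x xI zQ]; have [_ _ x0Q _ [_ c]] := hQ x xI.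
  by apply: connect_in_adjW (c _ _ x0Q zQ); exact: bigcup_sup.
Qed.

(** * Greedy choice of the branch sets *)

Definition nonadj (G : sgraph) (B : {set G}) : {set G} := [set v | [disjoint nbr v & B]].

Section Greedy.
Variables (G : sgraph) (s t : nat).
Hypothesis dl : dense_linked G.
Hypothesis s_gt0 : 0 < s.
Hypothesis G_gt0 : 0 < #|G|.
Hypothesis size_ok : 96 * (s * t) <= #|G|.
Hypothesis prob_ok : 2 * t * 4 ^ s * 3 ^ (s * s) <= 4 ^ (s * s).

(** The threshold [2 * #|G| * (3/4)^s] is twice a bound on the expected size of [nonadj] for a
    random [s]-tuple, as Markov's inequality requires. *)
Definition few_nonadj (B : {set G}) := 4 ^ s * #|nonadj B| <= 2 * #|G| * 3 ^ s.

Lemma nonadjS (A B : {set G}) : A \subset B -> nonadj B \subset nonadj A.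
Proof.
by move=> AB; apply/subsetP => v; rewrite !inE; apply: disjointWr.
Qed.

Definition tuple_set (f : {ffun 'I_s -> G}) : {set G} := [set f i | i : 'I_s].

Lemma tuple_set_avoid (Y A : {set G}) f :
  (f \in ffun_on Y) && [disjoint A & tuple_set f] = (f \in ffun_on (Y :\: A)).
Proof.
apply/andP/ffun_onP => [[/ffun_onP fY d] i|h].
  rewrite inE fY andbT; apply/negP => fA.
  by have := disjointFr d fA; rewrite imset_f.
split; first by apply/ffun_onP => i; have := h i; rewrite inE => /andP[].
apply/pred0P => z /=; apply/negP => /andP[zA /imsetP[i _ zi]].
by have := h i; rewrite inE -zi zA.
Qed.

(* Union bound over the tuples outside X: at most half of them miss many
   neighbourhoods (Markov), and fewer than half avoid all the neighbours of some
   previous branch set. *)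
Lemma good_tuple (X : {set G}) (L : seq {set G}) :
  16 * #|X| <= #|G| -> size L < t -> (forall B, B \in L -> few_nonadj B) ->
  exists f, [/\ f \in ffun_on (~: X), few_nonadj (tuple_set f) &
    forall B, B \in L -> exists u v, [/\ u \in B, v \in tuple_set f & adj u v]].
Proof.
move=> hX hL hB; set m := #|G| in hX *.
set Y := ~: X; set y := #|Y|.
have my : 16 * y >= 15 * m by rewrite /y /Y cardsCs setCK; move: hX; rewrite -/m; lia.
have ym : y <= m by exact: max_card.
have y0 : 0 < y by move: G_gt0 my; rewrite -/m; lia.
(* At least a third of all vertices are neighbours of [v], and [X] takes at most a sixteenth of all
   vertices; 1/3 - 1/16 exceeds 1/4. *)
have few v : 4 * #|Y :\: nbr v| <= 3 * y.
  have := dl.1 v; rewrite -/m => dv.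
  have : #|nbr v| <= #|Y :&: nbr v| + #|X|.
    rewrite -cardsUI; apply: leq_trans (leq_addr _ _); apply: subset_leq_card.
    by apply/subsetP => z; rewrite /Y !inE => ->; case: (z \in X).
  by have := cardsID (nbr v) Y; rewrite -/y; move: hX my; lia.
pose bad1 := [set f : {ffun 'I_s -> G} | (f \in ffun_on Y) && ~~ few_nonadj (tuple_set f)].
pose bad2 B := [set f : {ffun 'I_s -> G} | (f \in ffun_on Y) && (tuple_set f \subset nonadj B)].
have b1 : 2 * #|bad1| <= y ^ s.
  have S : \sum_(f in ffun_on Y) #|nonadj (tuple_set f)| = \sum_v #|Y :\: nbr v| ^ s.
    under eq_bigr do rewrite -sum1_card.
    rewrite (exchange_big_dep predT) //=; apply: eq_bigr => v _.
    rewrite -[X in _ ^ X](card_ord s) -card_ffun_on -sum1_card; apply: eq_bigl => f.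
    by rewrite -tuple_set_avoid [v \in _]inE.
  have S1 : 4 ^ s * (\sum_v #|Y :\: nbr v| ^ s) <= m * (3 ^ s * y ^ s).
    rewrite big_distrr /= -sum_nat_const; apply: leq_sum => v _.
    by rewrite -!expnMn leq_exp2r.
  have S2 : #|bad1| * (2 * m * 3 ^ s) <= 4 ^ s * (\sum_v #|Y :\: nbr v| ^ s).
    rewrite -S big_distrr /= -sum_nat_const.
    rewrite [X in _ <= X](bigID (fun f => ~~ few_nonadj (tuple_set f))) /=.
    apply: leq_trans (leq_addr _ _).
    rewrite (eq_bigl (fun f => (f \in ffun_on Y) && ~~ few_nonadj (tuple_set f)));
      last by move=> f; rewrite inE.
    by apply: leq_sum => f /andP[_]; rewrite /few_nonadj -ltnNge => /ltnW.
  rewrite -(@leq_pmul2r (m * 3 ^ s)) ?muln_gt0 ?G_gt0 ?expn_gt0 //.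
  move: (leq_trans S2 S1); move: (3 ^ s) (y ^ s) #|bad1| => p q r; lia.
(* These tuples lie entirely in [nonadj B], so there are at most [#|nonadj B| ^ s] of them. The
   factor [4 ^ s] comes from [2 * m <= 4 * y]. *)
have b2 B : B \in L -> 4 ^ (s * s) * #|bad2 B| <= 4 ^ s * 3 ^ (s * s) * y ^ s.
  move=> /hB fB; have c : #|bad2 B| <= #|nonadj B| ^ s.
    rewrite -[X in _ ^ X](card_ord s) -card_ffun_on; apply: subset_leq_card.
    apply/subsetP => f; rewrite inE => /andP[_ /subsetP h]; apply/ffun_onP => i.
    by apply: h; exact: imset_f.
  rewrite expnM; apply: (leq_trans (leq_mul (leqnn _) c)).
  rewrite -expnMn; apply: (@leq_trans ((2 * m * 3 ^ s) ^ s)); first by rewrite leq_exp2r.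
  rewrite expnMn -expnM mulnAC leq_mul2r -expnMn leq_exp2r //; apply/orP; right.
  by move: my; lia.
pose bad := bad1 :|: \bigcup_(B in [set B | B \in L]) bad2 B.
have : #|bad| < #|[set f : {ffun 'I_s -> G} | f \in ffun_on Y]|.
  have -> : #|[set f : {ffun 'I_s -> G} | f \in ffun_on Y]| = y ^ s.
    by rewrite cardsE card_ffun_on card_ord.
  have c2 : 4 ^ (s * s) * #|\bigcup_(B in [set B | B \in L]) bad2 B|
      <= size L * (4 ^ s * 3 ^ (s * s) * y ^ s).
    have p4 : 0 < 4 ^ (s * s) by rewrite expn_gt0.
    have le B : B \in [set B | B \in L] ->
        #|bad2 B| <= (4 ^ s * 3 ^ (s * s) * y ^ s) %/ 4 ^ (s * s).
      by rewrite inE => /b2 h; rewrite leq_divRL // mulnC.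
    apply: (leq_trans (leq_mul (leqnn _) (card_bigcup_le le))).
    rewrite mulnCA; apply: leq_mul; last by rewrite mulnC leq_divM.
    by rewrite cardsE; exact: card_size.
  have p3 : 0 < 3 ^ (s * s) by rewrite expn_gt0.
  have p4 : 0 < 4 ^ s by rewrite expn_gt0.
  have py : 0 < y ^ s by rewrite expn_gt0 y0.
  apply: (leq_ltn_trans (leq_card_setU _ _)).
  have lt : 4 ^ (s * s) * (2 * #|\bigcup_(B in [set B | B \in L]) bad2 B|) < 4 ^ (s * s) * y ^ s.
    rewrite mulnCA; apply: (leq_ltn_trans (leq_mul (leqnn 2) c2)).
    rewrite !mulnA ltn_pmul2r //; apply: leq_trans prob_ok.
    by rewrite -!mulnA !ltn_pmul2l // ltn_pmul2r // muln_gt0 p4.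
  by move: lt; rewrite ltn_pmul2l ?expn_gt0 //; move: b1; lia.
move=> lt; have [f fY fb] : exists2 f, f \in ffun_on Y & f \notin bad.
  have /subsetPn[f] : ~~ ([set f : {ffun 'I_s -> G} | f \in ffun_on Y] \subset bad).
    by apply: contraL lt => /subset_leq_card; rewrite leqNgt.
  by rewrite inE => fY fb; exists f.
move: fb; rewrite inE negb_or inE fY /= negbK => /andP[f1 f2].
exists f; split=> // B BL.
have : ~~ (tuple_set f \subset nonadj B).
  apply: contra f2 => sub; apply/bigcupP; exists B; first by rewrite inE.
  by rewrite inE fY.
case/subsetPn => v vf; rewrite inE => /pred0Pn[u /= /andP[]].
by rewrite inE => vu uB; exists u, v; split=> //; rewrite adj_sym.
Qed.

Definition touch (A B : {set G}) : bool :=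
  [disjoint A & B] && [exists u in A, exists v in B, adj u v].

(** A good tuple outside the earlier sets touches all of them. Connecting it multiplies its size by
    at most six and can only shrink [nonadj]; the total size is controlled by 96 = 16 * 6. *)
Lemma greedy_branch_sets i : i <= t -> exists L : seq {set G},
  [/\ size L = i, pairwise touch L &
     forall B, B \in L -> [/\ connected_in B, #|B| <= 6 * s & few_nonadj B]].
Proof.
elim: i => [|i IH] lt; first by exists [::].
have [L [sL pL hL]] := IH (ltnW lt).
pose X := \bigcup_(B in [set B | B \in L]) B.
have cX : 16 * #|X| <= #|G|.
  apply: leq_trans size_ok; rewrite -(_ : 16 * (t * (6 * s)) = 96 * (s * t)); last by lia.
  rewrite leq_mul2l; apply/orP; right.
  apply: leq_trans (card_bigcup_le (k := 6 * s) _) _.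
    by move=> B; rewrite inE => /hL[].
  rewrite leq_mul2r; apply/orP; right; rewrite cardsE.
  by apply: leq_trans (card_size _) _; rewrite sL ltnW.
have [||f [fY ff fadj]] := @good_tuple X L cX.
- by rewrite sL.
- by move=> B /hL[].
have fne : tuple_set f != set0.
  by apply/set0Pn; exists (f (Ordinal s_gt0)); exact: imset_f.
have fX : [disjoint tuple_set f & X].
  apply/pred0P => z /=; apply/negP => /andP[/imsetP[j _ ->] zX].
  by move/ffun_onP: fY => /(_ j); rewrite inE zX.
have [B [fB cB BX Bc]] := linked_connect dl.2 cX fne fX.
exists (B :: L); split; rewrite /= ?sL ?pL ?andbT //.
  apply/allP => C CL; apply/andP; split.
    by apply: disjointWr BX; apply: (bigcup_sup C); rewrite inE.
  have [u [v [uC vf uv]]] := fadj C CL.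
  apply/existsP; exists v; rewrite (subsetP fB) //=.
  by apply/existsP; exists u; rewrite uC adj_sym.
move=> C; rewrite inE => /orP[/eqP->|/hL//]; split=> //.
  apply: leq_trans cB _; rewrite leq_mul2l; apply/orP; right.
  by apply: leq_trans (leq_imset_card _ _) _; rewrite card_ord.
apply: leq_trans ff; rewrite leq_mul2l; apply/orP; right.
exact/subset_leq_card/nonadjS.
Qed.

Lemma dense_linked_minor : minor (complete t) G.
Proof.
have [L [sL pL hL]] := greedy_branch_sets (leqnn t).
pose phi (i : complete t) := nth set0 L i.
have LI (i : 'I_t) : phi i \in L by rewrite mem_nth // sL.
have T (i j : 'I_t) : i < j -> touch (phi i) (phi j).
  by move=> ij; apply: (pairwiseP set0 pL); rewrite // inE sL.
have lt_or (i j : 'I_t) : i != j -> (i < j) || (j < i) by rewrite -neq_ltn.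
exists phi; split=> [i|i j ij|i j ij].
- by case: (hL _ (LI i)).
- have /orP[/T/andP[]|/T/andP[]] := lt_or i j ij => //.
  by rewrite disjoint_sym.
- move: (lt_or i j ij) => /orP[]/T/andP[_ /existsP[u /andP[ui /existsP[v /andP[vj uv]]]]].
    by exists u, v.
  by exists v, u; rewrite adj_sym.
Qed.
End Greedy.

(* If G itself does not do, then the smaller component left by a small separator is
   almost complete. *)
Lemma half_dense_linked (G : sgraph) : 0 < #|G| -> (forall v : G, #|G| <= 2 * #|nbr v|) ->
  exists M : sgraph, [/\ minor M G, 7 * #|G| <= 16 * #|M| & dense_linked M].
Proof.
move=> G0 half; set n := #|G| in half *.
have degI (X : {set G}) (v : induced (~: X)) : n <= 2 * (#|nbr v| + #|X|).
  apply: leq_trans (half (val v)) _; rewrite leq_mul2l /= card_nbr_induced.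
  rewrite -cardsUI; apply: leq_trans (leq_addr _ _); apply: subset_leq_card.
  by apply/subsetP => z; rewrite !inE => ->; case: (z \in X).
have [con|] := pselect (forall X : {set G}, 16 * #|X| <= n ->
    forall u v : induced (~: X), connect (@adj _) u v).
  exists G; split; [exact: minor_refl|rewrite -/n; lia|split].
    by move=> v; have := half v; rewrite -/n; lia.
  move=> X hX u v uX vX.
  have uX' : u \in ~: X by rewrite inE.
  have vX' : v \in ~: X by rewrite inE.
  pose I := induced (~: X).
  pose u' : I := exist _ u uX'; pose v' : I := exist _ v vX'.
  have uv := con X hX u' v'.
  (* Otherwise some vertices at distances 0, 3 and 6 from [v'] have disjoint neighbourhoods, each
     with at least [7 n / 16] vertices, which is more than there are. *)
  have short : gdist u' v' <= 5.
    rewrite leqNgt; apply/negP => h6.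
    have [a av ad] := gdist_lower uv (n := 0) isT.
    have [b bv bd] := gdist_lower uv (n := 3) (ltnW (ltnW (ltnW h6))).
    have [c cv cd] := gdist_lower uv (n := 6) h6.
    have far (p q z : I) : connect (@adj I) q v' -> gdist q v' + 2 < gdist p v' ->
        adj p z -> adj q z -> False.
      move=> qv lt pz qz; rewrite adj_sym in qz.
      have zv := connect_trans (connect1 qz) qv.
      by have := gdist_adj pz zv; have := gdist_adj qz qv; lia.
    have dab : [disjoint nbr b & nbr a].
      apply/pred0P => z /=; apply/negP; rewrite !inE => /andP[bz az].
      by apply: (far b a z); rewrite ?ad ?bd.
    have dc : [disjoint nbr c & nbr b :|: nbr a].
      apply/pred0P => z /=; apply/negP; rewrite !inE => /andP[cz /orP[bz|az]].
        by apply: (far c b z); rewrite ?cd ?bd.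
      by apply: (far c a z); rewrite ?cd ?ad.
    have := max_card (mem (nbr c :|: (nbr b :|: nbr a))).
    rewrite !cardsU !disjoint_setI0 // cards0 !subn0 card_induced.
    have : #|~: X| <= n by exact: max_card.
    by have := degI X a; have := degI X b; have := degI X c; move: hX G0; rewrite -/n; lia.
  have [Q [cQ uQ vQ Qc]] := geodesic uv.
  exists (val @: Q); split.
  - by rewrite card_imset; [exact: leq_trans cQ _|exact: val_inj].
  - apply/pred0P => z /=; apply/negP => /andP[/imsetP[w _ ->]].
    by have := valP w; rewrite inE => /negbTE->.
  - by apply/imsetP; exists u'.
  - by apply/imsetP; exists v'.
  - exact: connected_in_induced.
move=> /existsNP[X /not_implyP[hX /existsNP[u /existsNP[v /negP nuv]]]].
set I := induced (~: X) in u v nuv.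
have csym : connect_sym (@adj I) by apply: sym_connect_sym; exact: adj_sym.
pose comp (w : I) : {set I} := [set z | connect (@adj I) w z].
(* A component with at most [n / 2] vertices has minimum degree at least [7 n / 16]. Two of its
   vertices thus have at least [6 n / 16] common neighbours, and one of them avoids [Y]. *)
have small (w : I) : 2 * #|comp w| <= n -> exists M : sgraph,
    [/\ minor M G, 7 * n <= 16 * #|M| & dense_linked M].
  move=> cw; exists (induced (comp w)).
  have deg (z : induced (comp w)) : 7 * n <= 16 * #|nbr z|.
    rewrite card_nbr_induced (setIidPl _).
      suff : n <= 2 * (#|nbr (val z)| + #|X|) by move: hX; lia.
      exact: degI.
    apply/subsetP => y; rewrite !inE => zy; have := valP z; rewrite inE => wz.
    exact: connect_trans wz (connect1 zy).
  have lt (z : induced (comp w)) := card_nbr_lt z.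
  have cM : #|induced (comp w)| = #|comp w| by rewrite card_induced.
  have w0 : w \in comp w by rewrite inE connect0.
  split; first exact: minor_trans (minor_induced _) (minor_induced _).
    by have := deg (exist _ w w0); have := lt (exist _ w w0); lia.
  split=> [z|Y hY a b aY bY].
    by have := deg z; move: cM cw; lia.
  have : ~~ (nbr a :&: nbr b \subset Y).
    apply/negP => /subset_leq_card.
    have mU : #|nbr a :|: nbr b| <= #|comp w| by rewrite -cM; exact: max_card.
    move: (cardsUI (nbr a) (nbr b)) mU (deg a) (deg b) hY cw G0; rewrite cM -/n.
    by move: #|_ :|: _| #|_ :&: _| #|nbr a| #|nbr b| #|Y| #|comp w|; lia.
  case/subsetPn => z; rewrite !inE => /andP[az bz] zY.
  exists ([set a; z] :|: [set z; b]); split.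
  - apply: leq_trans (leq_card_setU _ _) _; rewrite !cards2.
    by case: (a != z); case: (z != b).
  - rewrite -setI_eq0; apply/eqP/setP => y; rewrite !inE; apply/negP => /andP[+ yY].
    by move=> /orP[]/orP[]/eqP e; move: aY bY zY; rewrite -e yY.
  - by rewrite !inE eqxx.
  - by rewrite !inE eqxx !orbT.
  - by apply: (@connected_inU _ _ _ z); rewrite ?inE ?eqxx ?orbT //;
      apply: connected_in2; rewrite // adj_sym.
have dcomp : [disjoint comp u & comp v].
  apply/pred0P => z /=; apply/negP; rewrite !inE => /andP[uz vz].
  by apply: (negP nuv); apply: connect_trans uz _; rewrite csym.
have : #|comp u| + #|comp v| <= n.
  rewrite -cardsUI disjoint_setI0 // cards0 addn0.
  by apply: leq_trans (max_card _) _; rewrite card_induced; exact: max_card.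
have [cu|cu] := leqP (2 * #|comp u|) n => le; first exact: small cu.
by apply: (small v); lia.
Qed.

(** Some neighbourhood in the reduced minor has more than [220 s t] vertices and minimum degree at
    least half its order. [half_dense_linked] keeps 7/16 of the vertices, and 220 * 7 / 16 is just
    above the 96 needed. *)
Lemma dense_complete_minor (G : sgraph) (s t : nat) : 0 < s ->
  2 * t * 4 ^ s * 3 ^ (s * s) <= 4 ^ (s * s) -> 0 < t -> 0 < #|G| ->
  220 * (s * t) * #|G| <= #|edges G| -> minor (complete t) G.
Proof.
move=> s0 ok t0 G0 dense.
have st0 : 0 < s * t by rewrite muln_gt0 s0.
have [|//||M [MG nM mM tri deg]] := @dense_minor (220 * (s * t)) 0 1 G.
- by rewrite !muln0 muln1 /= ; move: st0; lia.
- by rewrite addn0.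
apply: minor_trans MG; set b := 220 * (s * t) in mM tri deg.
have [x dx] : exists x : M, #|nbr x| <= 2 * b.
  apply/existsP; apply: contraT; rewrite negb_exists => /forallP big.
  have : #|M| * (2 * b).+1 <= degsum M.
    rewrite -sum_nat_const; apply: leq_sum => x _; by have := big x; rewrite -ltnNge.
  by rewrite degsumE; move: mM nM; nia.
apply: minor_trans (minor_induced (nbr x)).
have [||K [KM nK dK]] := @half_dense_linked (induced (nbr x)).
- by rewrite card_induced; apply: leq_ltn_trans (deg x).
- move=> y; rewrite card_induced card_nbr_induced setIC.
  apply: leq_trans dx _; rewrite leq_mul2l /=; apply: tri.
  by have := valP y; rewrite inE.
have nK' : 96 * (s * t) <= #|K|.
  by move: nK; rewrite card_induced; have := deg x; rewrite /b; lia.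
apply: minor_trans KM; apply: (@dense_linked_minor K s t) => //.
by apply: leq_trans nK'; move: st0; lia.
Qed.

(** * The Delaunay graph of a family of balls *)

Section Delaunay.
Variables (G : sgraph) (S : {set {set G}}).

Definition delaunay_rel : rel {set G} := [rel A B | (A != B) &&
  [exists x in A :&: B, [forall (C | (C \in S) && (x \in C)), (C == A) || (C == B)]]].

Lemma delaunay_sym : symmetric delaunay_rel.
Proof.
move=> A B; rewrite /delaunay_rel /= eq_sym setIC; congr (_ && _).
apply: eq_existsb => x; congr (_ && _); apply: eq_forallb => C.
by rewrite [(C == A) || _]orbC.
Qed.

Lemma delaunay_irrefl : irreflexive delaunay_rel.
Proof. by move=> A; rewrite /delaunay_rel /= eqxx. Qed.

Definition delaunay := SGraph delaunay_sym delaunay_irrefl.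

Hypothesis ballS : ball_hypergraph S.
Hypothesis antichain : {in S &, forall A B : {set G}, A \subset B -> A = B}.

(* The branch set of a ball is its additively weighted Voronoi cell: [key] orders the
   balls by distance to the center minus radius, with ties broken by rank. *)
Lemma delaunay_minor : minor (@induced delaunay S) G.
Proof.
have [->|/set0Pn[A0 A0S]] := eqVneq S set0.
  have E (x : induced (set0 : {set delaunay})) : False by have := valP x; rewrite inE.
  by exists (fun x => False_rect _ (E x)); split=> x; case: (E x).
have [r0 [c0 _]] := ballS A0S.
have /all_sig[rc hrc] : forall A : {set G}, {rc : nat * G | A \in S -> A = Defs.ball rc.1 rc.2}.
  move=> A; apply: cid; have [/ballS[r [c ->]]|] := boolP (A \in S); last by exists (r0, c0).
  by exists (r, c).
pose r A := (rc A).1; pose c A := (rc A).2.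
have inA A x : A \in S -> (x \in A) = connect (@adj G) x (c A) && (gdist x (c A) <= r A).
  by move=> AS; rewrite {1}(hrc A AS) inE.
pose rmax := \max_(A in S) r A.
have r_le A : A \in S -> r A <= rmax by move=> AS; rewrite /rmax (bigD1 A) //= leq_maxl.
pose N := #|{set G}|.
(* Adding [rmax] keeps distance minus radius within the natural numbers. In [key] the factor [N]
   exceeds every rank, so ranks decide only ties. *)
pose h A x := gdist x (c A) + (rmax - r A).
pose key A x := h A x * N + enum_rank A.
have rank_lt (A : {set G}) : enum_rank A < N by rewrite /N ltn_ord.
have key_inj A B x : key A x = key B x -> A = B.
  move=> /(congr1 (modn^~ N)); rewrite /key !modnMDl !modn_small //.
  by move/val_inj/enum_rank_inj.
have key_le A B x : key A x <= key B x -> h A x <= h B x.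
  move=> le; rewrite leqNgt; apply/negP => lt.
  have : (h B x).+1 * N <= h A x * N by rewrite leq_mul2r lt orbT.
  by move: le (rank_lt B); rewrite /key mulSn; lia.
have h_lt A B x : h A x < h B x -> key A x <= key B x.
  move=> lt; have : (h A x).+1 * N <= h B x * N by rewrite leq_mul2r lt orbT.
  by move: (rank_lt A); rewrite /key mulSn; lia.
have key_adj C x y : adj x y -> connect (@adj G) y (c C) -> key C x <= key C y + N.
  move=> xy yc; rewrite /key addnAC leq_add2r -mulSnr leq_mul2r /h.
  by rewrite -addSn leq_add2r gdist_adj ?orbT.
have key_step A x y n : gdist x (c A) = n.+1 -> gdist y (c A) = n -> key A x = key A y + N.
  by rewrite /key /h => -> ->; rewrite addSn mulSn; lia.
pose nearest A x (P : pred {set G}) :=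
  forall C, C \in S -> P C -> connect (@adj G) x (c C) -> key A x <= key C x.
pose cell A := [set x | connect (@adj G) x (c A) &&
  [forall (C | C \in S), connect (@adj G) x (c C) ==> (key A x <= key C x)]].
have cellP A x : reflect (connect (@adj G) x (c A) /\ nearest A x predT) (x \in cell A).
  rewrite inE; apply: (iffP andP) => -[xc hC]; split=> //.
    by move=> C CS _ xC; move/forall_inP: hC => /(_ C CS); rewrite xC.
  by apply/forall_inP => C CS; apply/implyP => xC; exact: hC.
have adjC x y z : adj x y -> connect (@adj G) x z -> connect (@adj G) y z.
  by move=> xy; apply: connect_trans; apply: connect1; rewrite adj_sym.
(* A step towards the center of [A] lowers the key of [A] by exactly [N], and no other key drops by
   more. *)
have nearest_step A x P n : connect (@adj G) x (c A) -> gdist x (c A) = n.+1 ->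
    nearest A x P -> exists y, [/\ adj x y, connect (@adj G) y (c A),
      gdist y (c A) = n & nearest A y P].
  move=> xc xn hx; have [y [xy yc yn]] := gdist_step xc xn; exists y; split=> //.
  move=> C CS PC yC; have := hx C CS PC (connect_trans (connect1 xy) yC).
  rewrite (key_step A x y n) // => le; have := key_adj C x y xy yC.
  by move: le; lia.
(* A set [C] with a smaller key at the center of [A] would contain [A] by the triangle inequality,
   against the antichain hypothesis. *)
have cell_center A : A \in S -> c A \in cell A.
  move=> AS; apply/cellP; split; first exact: connect0.
  move=> C CS _ AC; rewrite leqNgt; apply/negP => lt.
  have /antichain : A \subset C.
    apply/subsetP => x; rewrite !inA // => /andP[xA xr].
    rewrite (connect_trans xA AC) /=; apply: leq_trans (gdist_triangle xA AC) _.
    have := key_le _ _ _ (ltnW lt); rewrite /h gdistxx add0n.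
    by move: xr (r_le A AS) (r_le C CS); lia.
  by move=> /(_ AS CS) e; rewrite e ltnn in lt.
have cell_star A x : x \in cell A -> connect (in_adj (cell A)) x (c A).
  move eD : (gdist x (c A)) => D; elim: D x eD => [|D IH] x eD xA.
    by have [xc _] := cellP _ _ xA; rewrite (gdist0 xc eD) connect0.
  have [xc hx] := cellP _ _ xA.
  have [y [xy yc yD hy]] := nearest_step A x predT D xc eD hx.
  have yA : y \in cell A by apply/cellP.
  by apply: connect_trans (IH y yD yA); apply: connect1; rewrite /in_adj /= xA yA.
have cell_disj A B x : A \in S -> B \in S -> x \in cell A -> x \in cell B -> A = B.
  move=> AS BS /cellP[xA hA] /cellP[xB hB]; apply: (key_inj _ _ x).
  by apply/eqP; rewrite eqn_leq hA ?hB.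
have cell_or A B x : A \in S -> B \in S -> connect (@adj G) x (c A) ->
    connect (@adj G) x (c B) -> nearest B x [pred C | (C != A) && (C != B)] ->
    nearest A x [pred C | (C != A) && (C != B)] \/ key B x <= key A x ->
    (x \in cell A) || (x \in cell B).
  move=> AS BS xA xB hB hA; have [le|lt] := leqP (key B x) (key A x).
    apply/orP; right; apply/cellP; split=> // C CS _ xC.
    have [->|CA] := eqVneq C A; first by [].
    have [->|CB] := eqVneq C B; first by [].
    by apply: hB; rewrite //= CA.
  apply/orP; left; apply/cellP; split=> // C CS _ xC.
  have [->|CA] := eqVneq C A; first by [].
  have [->|CB] := eqVneq C B; first exact: ltnW.
  by apply: leq_trans (ltnW lt) _; apply: hB; rewrite //= CA.
(* On a geodesic from the cell of [A] to the center of [B], no third set ever comes first, so some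
   edge passes directly from one cell to the other. *)
have walk_to A B x : A \in S -> B \in S -> A != B -> x \in cell A ->
    connect (@adj G) x (c B) -> nearest B x [pred C | (C != A) && (C != B)] ->
    exists u v, [/\ u \in cell A, v \in cell B & adj u v].
  move=> AS BS AB; move eD : (gdist x (c B)) => D.
  elim: D x eD => [|D IH] x eD xA xB hx.
    have e := gdist0 xB eD; move: xA; rewrite e => cA.
    by have := cell_disj _ _ _ AS BS cA (cell_center B BS) => e'; rewrite e' eqxx in AB.
  have [y [xy yB yD hy]] := nearest_step B x _ D xB eD hx.
  have [xcA _] := cellP _ _ xA; have yA := adjC _ _ _ xy xcA.
  have /orP[yA'|yB'] : (y \in cell A) || (y \in cell B).
    apply: cell_or => //; have [le|lt] := leqP (key B y) (key A y); first by right.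
    left=> C CS PC yC; apply: leq_trans (ltnW lt) _; exact: hy.
  - exact: IH yD yA' yB hy.
  - by exists x, y.
exists (fun A => cell (val A)); split=> [A|A B AB|A B].
- have AS : val A \in S := valP A.
  apply: (connected_in_root (cell_center _ AS)) => x xA.
  by rewrite in_adj_sym; exact: cell_star.
- apply/pred0P => x /=; apply/negP => /andP[xA xB]; move: AB.
  by rewrite -val_eqE (cell_disj _ _ _ (valP A) (valP B) xA xB) eqxx.
have AS : val A \in S := valP A; have BS : val B \in S := valP B.
case/andP=> AB /existsP[x /andP[]]; rewrite inE => /andP[xA xB] /forallP priv.
(* A third set [C] does not contain [x], so distance minus radius is positive for [C], while it is
   at most 0 for [D]. *)
have near D : D \in S -> x \in D -> nearest D x [pred C | (C != val A) && (C != val B)].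
  move=> DS xD C CS /= /andP[CA CB] xC; apply: h_lt.
  have xnC : x \notin C.
    by apply/negP => xC'; have := priv C; rewrite CS xC' /= (negbTE CA) (negbTE CB).
  move: xnC xD; rewrite !inA // xC /= -ltnNge => lt /andP[_ le].
  by rewrite /h; move: (r_le C CS) (r_le D DS); lia.
have hA := near _ AS xA; have hB := near _ BS xB.
move: (xA) (xB); rewrite !inA // => /andP[xcA _] /andP[xcB _].
have /orP[cA|cB] : (x \in cell (val A)) || (x \in cell (val B)).
  by apply: (cell_or _ _ _ AS BS xcA xcB hB); left; exact: hA.
- exact: walk_to cA xcB hB.
- have BA : val B != val A by rewrite eq_sym.
  have hA' : nearest (val A) x [pred C | (C != val B) && (C != val A)].
    by move=> C CS /andP[CB CA]; apply: hA; rewrite //= CA CB.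
  have [u [v [uB vA uv]]] := walk_to _ _ x BS AS BA cB xcA hA'.
  by exists v, u; rewrite adj_sym.
Qed.
End Delaunay.

(** * Fractional matchings *)

Section Sampling.
Variables (R : realType) (I : finType) (p : I -> R).
Local Open Scope ring_scope.
Hypothesis p01 : forall i, 0 <= p i <= 1.

Definition sample_prob (S : {set I}) : R := \prod_i (if i \in S then p i else 1 - p i).

Lemma sample_prob_ge0 (S : {set I}) : 0 <= sample_prob S.
Proof. by apply: prodr_ge0 => i _; have := p01 i; case: ifP => _; lra. Qed.

Lemma sample_prob_eq0 (S : {set I}) i : i \in S -> p i = 0 -> sample_prob S = 0.
Proof. by move=> iS pi; rewrite /sample_prob (bigD1 i) //= iS pi mul0r. Qed.

(** The probability that a random set contains [T] and avoids [K]. The indicator kills the factors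
    [p i] on [K] and [1 - p i] on [T], and the sum over [S] is the expansion of a product of
    two-term sums. *)
Lemma sample_event (T K : {set I}) : [disjoint T & K] ->
  \sum_S sample_prob S * ((T \subset S) && [disjoint S & K])%:R =
  \prod_(i in T) p i * \prod_(i in K) (1 - p i).
Proof.
move=> dTK.
pose F i := p i * (i \notin K)%:R; pose H i := (1 - p i) * (i \notin T)%:R.
transitivity (\prod_i (F i + H i)).
  rewrite bigA_distr; apply: eq_bigr => S _.
  have [/andP[TS dSK]|n] := boolP (_ && _).
    rewrite mulr1; apply: eq_bigr => i _; rewrite /F /H.
    case: ifP => iS; first by rewrite (disjointFr dSK iS) mulr1.
    rewrite (_ : i \notin T) ?mulr1 //.
    by apply: contraFN iS => iT; exact: (subsetP TS).
  rewrite mulr0; apply/esym/eqP/prodf_eq0.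
  move: n; rewrite negb_and => /orP[/subsetPn[i iT niS]|/pred0Pn[i /andP[/= iS iK]]].
    by exists i; rewrite // (negbTE niS) /H iT mulr0.
  by exists i; rewrite // iS /F iK mulr0.
rewrite (big_mkcond (mem T)) (big_mkcond (mem K)) -big_split /=.
apply: eq_bigr => i _; rewrite /F /H.
case: (boolP (i \in T)) => iT /=.
  by rewrite (disjointFr dTK iT) /= mulr0 addr0.
by case: (i \in K); rewrite /= ?mulr0 ?mulr1 ?mul1r ?add0r // addrC subrK.
Qed.

Lemma sample_card : \sum_S sample_prob S * #|S|%:R = \sum_i p i.
Proof.
transitivity (\sum_S \sum_i sample_prob S * (i \in S)%:R).
  by apply: eq_bigr => S _; rewrite -sum1_card natr_sum big_mkcond mulr_sumr /=;
     apply: eq_bigr => i _; case: (i \in S).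
rewrite exchange_big /=; apply: eq_bigr => i _.
have := @sample_event [set i] set0; rewrite big_set0 mulr1 big_set1 => <-.
  by apply: eq_bigr => S _; rewrite sub1set -setI_eq0 setI0 eqxx andbT.
by rewrite -setI_eq0 setI0.
Qed.
End Sampling.

(** * The maximum average degree of a minor *)

Section AverageDegree.
Variable R : realType.
Local Open Scope ring_scope.

Lemma avg_degree_degsum (G : sgraph) : avg_degree R G = (degsum G)%:R / #|G|%:R.
Proof. by rewrite /avg_degree degsumE. Qed.

Lemma card_minor (M G : sgraph) : minor M G -> (#|M| <= #|G|)%N.
Proof.
case=> phi [cphi dphi _].
have /all_sig[f hf] : forall x, {u | u \in phi x}.
  by move=> x; apply: cid; have [/set0Pn[u ux] _] := cphi x; exists u.
apply: (@leq_card _ _ f) => x y e; apply/eqP; apply: contraT => /dphi.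
by move/pred0P/(_ (f x)); rewrite /= hf e hf.
Qed.

Lemma avg_degree_le_card (G : sgraph) : avg_degree R G <= #|G|%:R.
Proof.
rewrite avg_degree_degsum.
have [->|G0] := posnP #|G|; first by rewrite invr0 mulr0.
rewrite ler_pdivrMr ?ltr0n // -natrM ler_nat -sum_nat_const.
by apply: leq_sum => x _; exact: max_card.
Qed.

Lemma avg_degree_le_max (M G : sgraph) :
  minor M G -> avg_degree R M <= max_minor_avg_degree R G.
Proof.
move=> MG; apply: ub_le_sup; last by exists M.
exists #|G|%:R => _ [K [KG ->]]; apply: le_trans (avg_degree_le_card K) _.
by rewrite ler_nat card_minor.
Qed.

Lemma max_minor_avg_degree_le (G : sgraph) (b : R) :
  (forall M : sgraph, minor M G -> avg_degree R M <= b) -> max_minor_avg_degree R G <= b.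
Proof.
move=> h; apply: ge_sup; first by exists (avg_degree R G), G; split=> //; exact: minor_refl.
by move=> _ [M [MG ->]]; exact: h.
Qed.

(** A single edge is a minor of average degree 1. *)
Lemma max_minor_avg_degree_ge1 (G : sgraph) :
  edges G != set0 -> 1 <= max_minor_avg_degree R G.
Proof.
case/set0Pn => A; rewrite inE => /existsP[x /existsP[y /andP[xy _]]].
have cS : #|[set x; y]| = 2%N by rewrite cards2 (adj_neq xy).
apply: le_trans (avg_degree_le_max (minor_induced [set x; y])).
rewrite avg_degree_degsum card_induced cS degsum_induced.
rewrite ler_pdivlMr ?ltr0n // mul1r ler_nat.
rewrite -{1}cS -sum1_card; apply: leq_sum => z /set2P[]->; apply/card_gt0P.
  by exists y; rewrite !inE xy eqxx orbT.
by exists x; rewrite !inE adj_sym xy eqxx.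
Qed.
End AverageDegree.

(** * A ball that meets little weight *)

Section PackingBound.
Variables (R : realType) (G : sgraph).
Local Open Scope ring_scope.
Let d := max_minor_avg_degree R G.

Lemma delaunay_sparse (S : {set {set G}}) :
  ball_hypergraph S -> {in S &, forall A B : {set G}, A \subset B -> A = B} ->
  (\sum_(A in S) #|[set B in S | delaunay_rel S A B]|)%:R <= d * #|S|%:R.
Proof.
move=> bS aS; have := avg_degree_le_max R (delaunay_minor bS aS).
rewrite avg_degree_degsum card_induced degsum_induced -/d.
rewrite (eq_bigr (fun A => #|[set B in S | delaunay_rel S A B]|)); last first.
  by move=> A _; apply: eq_card => B; rewrite !inE andbC.
have [S0|S0] := posnP #|S|.
  move=> _; rewrite S0 mulr0 (eq_bigl pred0) ?big_pred0 // => A.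
  by apply: card0_eq S0 A.
by rewrite ler_pdivrMr ?ltr0n.
Qed.

Variables (F : {set {set G}}) (w : {set G} -> R).
Hypothesis ballF : ball_hypergraph F.
Hypothesis antichainF : {in F &, forall A B : {set G}, A \subset B -> A = B}.
Hypothesis fracw : fractional_matching F w.

(** The odds [p / (1 - p)] of sampling [A] with probability [p = 1 - expR (- w A)]. *)
Let u A := expR (w A) - 1.

Lemma weight_le1 A : A \in F -> w A <= 1.
Proof.
move=> AF; have [r [v Ev]] := ballF AF.
have vA : v \in A by rewrite Ev inE connect0 gdistxx.
apply: le_trans (fracw.2 v); rewrite (bigD1 A) ?AF //= lerDl.
by apply: sumr_ge0 => B /andP[/andP[BF _] _]; exact: fracw.1.
Qed.

(* Expected number of edges of the Delaunay graph of a random sample of F. *)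
Lemma meeting_pairs_bound :
  \sum_(A in F) \sum_(B in F | (A != B) && ~~ [disjoint A & B]) u A * u B <=
  expR 1 * d * \sum_(A in F) u A * expR (- w A).
Proof.
pose p A := if A \in F then 1 - expR (- w A) else 0.
have p01 A : 0 <= p A <= 1.
  rewrite /p; case: ifP => AF; last by rewrite lexx ler01.
  by have := fracw.1 A AF; have := expR_gt0 (- w A); rewrite -oppr_le0 -expR_le1; lra.
have /all_sig[x hx] : forall AB : {set G} * {set G}, {o : option G |
    if o is Some x then x \in AB.1 :&: AB.2 else [disjoint AB.1 & AB.2]}.
  move=> [A B]; apply: cid => /=.
  have [dAB|/pred0Pn[z /andP[zA zB]]] := boolP [disjoint A & B]; first by exists None.
  by exists (Some z); rewrite inE; apply/andP.
pose K A B := [set C in F | (if x (A, B) is Some z then z \in C else false) && (C != A) && (C != B)].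
have uE A : A \in F -> u A * expR (- w A) = p A.
  by move=> AF; rewrite /u /p AF mulrBl -expRD subrr expR0 mul1r.
(* With probability [u A * u B * expR (- s)], both sets are sampled but no other set at their chosen
   common vertex; here [s] is a sum of weights at that vertex, hence at most 1. *)
have pair A B : A \in F -> B \in F -> A != B -> ~~ [disjoint A & B] ->
    u A * u B <= expR 1 * \sum_S sample_prob p S * (([set A; B] \subset S) && [disjoint S & K A B])%:R.
  move=> AF BF AB meetAB; rewrite sample_event; last first.
    apply/pred0P => C /=; apply/negP => /andP[/set2P[]->]; by rewrite !inE eqxx /= ?andbF.
  rewrite big_setU1 ?inE //= big_set1 -!uE //.
  have := hx (A, B); case E : (x (A, B)) => [z|] /=; last by rewrite (negbTE meetAB).
  rewrite inE => /andP[zA zB].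
  have KE C : (C \in K A B) = [&& (C \in F) && (z \in C), C != A & C != B].
    by rewrite inE E !andbA.
  rewrite (eq_bigr (fun C => expR (- w C))); last first.
    by move=> C; rewrite KE /p => /andP[/andP[-> _] _]; rewrite opprB addrC subrK.
  rewrite -expR_sum sumrN.
  have le1 : \sum_(C in K A B) w C + w A + w B <= 1.
    apply: le_trans (fracw.2 z).
    rewrite [X in _ <= X](bigD1 A) ?AF ?zA //= [X in _ <= _ + X](bigD1 B) ?BF ?zB 1?eq_sym ?AB //=.
    rewrite (eq_bigl (fun C => (C \in F) && (z \in C) && (C != A) && (C != B))).
      by lra.
    by move=> C; rewrite KE !andbA.
  have uA0 : 0 <= u A by rewrite /u subr_ge0 -expR0 ler_expR; exact: fracw.1.
  have uB0 : 0 <= u B by rewrite /u subr_ge0 -expR0 ler_expR; exact: fracw.1.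
  rewrite [X in _ <= X](_ : _ = (u A * u B) * expR (1 - w A - w B - \sum_(C in K A B) w C)).
    by rewrite ler_peMr ?mulr_ge0 // leNgt expR_lt1 -leNgt; lra.
  by rewrite !expRD; ring.
apply: (@le_trans _ _ (expR 1 * \sum_S sample_prob p S * (d * #|S|%:R))); last first.
  rewrite -mulrA ler_pM2l ?expR_gt0 //.
  under eq_bigr do rewrite mulrCA.
  rewrite -mulr_sumr sample_card; suff -> : \sum_A p A = \sum_(A in F) u A * expR (- w A) by [].
  rewrite [RHS]big_mkcond /=; apply: eq_bigr => A _.
  by have := uE A; rewrite /p; case: ifP => // AF ->.
pose good (S : {set {set G}}) A B := ([set A; B] \subset S) && [disjoint S & K A B].
apply: (@le_trans _ _ (\sum_(A in F) \sum_(B in F | (A != B) && ~~ [disjoint A & B])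
    expR 1 * \sum_S sample_prob p S * (good S A B)%:R)).
  apply: ler_sum => A AF; apply: ler_sum => B /and3P[BF AB meetAB]; exact: pair.
under eq_bigr do rewrite -mulr_sumr exchange_big /=.
rewrite -mulr_sumr exchange_big /= ler_pM2l ?expR_gt0 //.
(* For a fixed sample, the chosen vertex of a good pair witnesses an edge of the Delaunay graph, so
   [delaunay_sparse] bounds their number. *)
apply: ler_sum => S _.
have [SF|/subsetPn[A AS AF]] := boolP (S \subset F); last first.
  have p0 : sample_prob p S = 0 by apply: (sample_prob_eq0 AS); rewrite /p (negbTE AF).
  rewrite p0 mul0r big1 // => A' _; rewrite big1 // => B' _; exact: mul0r.
have bS : ball_hypergraph S by move=> A AS; apply: ballF; exact: (subsetP SF).
have aS : {in S &, forall A B : {set G}, A \subset B -> A = B}.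
  by move=> A B AS BS; apply: antichainF; exact: (subsetP SF).
under eq_bigr do rewrite -mulr_sumr.
rewrite -mulr_sumr ler_wpM2l ?sample_prob_ge0 //.
apply: le_trans (delaunay_sparse bS aS).
rewrite (eq_bigr (fun A => (\sum_(B in F | (A != B) && ~~ [disjoint A & B])
    nat_of_bool (good S A B))%:R)); last by move=> A _; rewrite natr_sum.
rewrite -natr_sum ler_nat big_mkcond [X in (_ <= X)%N]big_mkcond /=.
apply: leq_sum => A _; case: ifP => // AF; case: ifP => AS; last first.
  rewrite big1 // => B _; rewrite /good (_ : _ \subset _ = false) //.
  by apply/negP => /subsetP/(_ A); rewrite !inE eqxx AS => /(_ isT).
rewrite -sum1_card big_mkcond [X in (_ <= X)%N]big_mkcond /=.
apply: leq_sum => B _; rewrite /good; case: ifP => // /and3P[BF AB meetAB].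
case: (boolP (_ && _)) => // /andP[sub dK].
have BS : B \in S by apply: (subsetP sub); rewrite !inE eqxx orbT.
rewrite inE BS /= (_ : delaunay_rel S A B) //; apply/andP; split=> //.
have := hx (A, B); case E : (x (A, B)) => [z|] /= zAB; last by rewrite zAB in meetAB.
apply/existsP; exists z; rewrite zAB /=; apply/forall_inP => C /andP[CS zC].
apply: contraT; rewrite negb_or => /andP[CA CB].
by have := disjointFr dK CS; rewrite inE E zC CA CB (subsetP SF C CS).
Qed.
Hypothesis edgeG : edges G != set0.

(** If every ball were heavy, the [u]-weighted sum of the [N A] would be too large for
    [meeting_pairs_bound] together with the diagonal terms. *)
Lemma light_ball : F != set0 ->
  exists2 A, A \in F & \sum_(B in F | ~~ [disjoint A & B]) u B <= expR 1 * d.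
Proof.
move=> F0; have d1 : 1 <= d := max_minor_avg_degree_ge1 R edgeG.
have e0 : 0 < expR 1 :> R := expR_gt0 1.
have u0 A : A \in F -> 0 <= u A.
  by move=> AF; rewrite /u subr_ge0 -expR0 ler_expR; exact: fracw.1.
pose N (A : {set G}) := \sum_(B in F | ~~ [disjoint A & B]) u B.
have NE A : A \in F -> N A = u A + \sum_(B in F | (A != B) && ~~ [disjoint A & B]) u B.
  move=> AF; rewrite /N (bigD1 A) /=; last first.
    have [r [v Ev]] := ballF AF; rewrite AF /=; apply/pred0Pn; exists v.
    by rewrite /= Ev inE connect0 gdistxx.
  by congr (_ + _); apply: eq_bigl => B; rewrite -andbA eq_sym [_ && ~~ _]andbC andbA andbAC -andbA.
have [//|heavy] := pselect (exists2 A, A \in F & N A <= expR 1 * d).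
have {}heavy A : A \in F -> expR 1 * d < N A.
  by move=> AF; rewrite ltNge; apply/negP => h; apply: heavy; exists A.
have total : \sum_(A in F) u A * N A <= \sum_(A in F) u A * (expR 1 * d).
  apply: (@le_trans _ _ (\sum_(A in F) (u A * u A +
      \sum_(B in F | (A != B) && ~~ [disjoint A & B]) u A * u B))).
    by apply: ler_sum => A AF; rewrite NE // mulrDr mulr_sumr.
  rewrite big_split /=; apply: le_trans (lerD (lexx _) meeting_pairs_bound) _.
  rewrite mulr_sumr -big_split /=; apply: ler_sum => A AF.
  have uA := u0 A AF; have wA := weight_le1 AF.
  have ewA : expR (w A) <= expR 1 * d.
    by apply: (@le_trans _ _ (expR 1)); rewrite ?ler_expR // ler_peMr // ltW.
  (* The diagonal term fits because [expR (w A) <= expR 1 * d], which uses [w A <= 1] and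
     [1 <= d]. *)
  have -> : u A * u A + expR 1 * d * (u A * expR (- w A)) =
      u A * (expR 1 * d) - u A * u A * (expR 1 * d * expR (- w A) - 1).
    have : expR (w A) * expR (- w A) = 1 by rewrite -expRD subrr expR0.
    rewrite /u => ee; apply/eqP; rewrite -subr_eq0; apply/eqP.
    transitivity ((expR (w A) - 1) * (expR 1 * d) * (expR (w A) * expR (- w A) - 1)).
      by ring.
    by rewrite ee subrr mulr0.
  rewrite lerBlDr lerDl mulr_ge0 ?mulr_ge0 // subr_ge0.
  by rewrite expRN ler_pdivlMr ?expR_gt0 // mul1r.
(* Strictness could fail only if [u] vanishes on [F], but then [N A] is 0 and not heavy. *)
have uN : forall A, A \in F -> u A * (N A - expR 1 * d) = 0.
  apply: psumr_eq0P => [B BF|]; first by rewrite mulr_ge0 ?u0 // subr_ge0 ltW // heavy.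
  apply/eqP; rewrite eq_le; apply/andP; split.
    by under eq_bigr do rewrite mulrBr; rewrite sumrB subr_le0.
  by apply: sumr_ge0 => B BF; rewrite mulr_ge0 ?u0 // subr_ge0 ltW // heavy.
case/set0Pn: F0 => A AF; have := heavy A AF.
rewrite /N big1 => [|B /andP[BF _]].
  by rewrite ltNge mulr_ge0 ?ltW // (lt_le_trans _ d1).
apply/eqP; have /eqP := uN B BF; rewrite mulf_eq0 => /orP[//|].
by rewrite subr_eq0 gt_eqF ?heavy.
Qed.
End PackingBound.

(** * From light balls to matchings *)

Section Packing.
Variables (R : realType) (G : sgraph).
Local Open Scope ring_scope.
Hypothesis edgeG : edges G != set0.
Let K : R := expR 1 * max_minor_avg_degree R G.

(** Greedy choice: a light ball joins the matching, and the balls meeting it, of total [u]-weight at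
    most [K], are discarded. The induction bounds the weights [expR (w A) - 1], which dominate
    [w A]. *)
Lemma packing_antichain (F : {set {set G}}) (w : {set G} -> R) :
  ball_hypergraph F -> {in F &, forall A B : {set G}, A \subset B -> A = B} ->
  fractional_matching F w ->
  exists2 M : {set {set G}}, (M \subset F) && trivIset M &
    \sum_(A in F) w A <= K * #|M|%:R.
Proof.
move=> bF aF fF.
suff [M MF le] : exists2 M : {set {set G}}, (M \subset F) && trivIset M &
    \sum_(A in F) (expR (w A) - 1) <= K * #|M|%:R.
  exists M => //; apply: le_trans le; apply: ler_sum => A _.
  by have := expR_ge1Dx (w A); lra.
move: {2}_.+1 (ltnSn #|F|) => n; elim: n F bF aF fF => // n IH F bF aF fF leF.
have [->|F0] := eqVneq F set0.
  exists set0; last by rewrite big_set0 cards0 mulr0.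
  by rewrite sub0set; apply/trivIsetP => A B; rewrite inE.
have [A AF light] := light_ball bF aF fF edgeG F0.
pose F' := [set B in F | [disjoint A & B]].
have sF : F' \subset F by apply/subsetP => B; rewrite inE => /andP[].
have An0 : A != set0.
  have [r [v ->]] := bF A AF; apply/set0Pn; exists v.
  by rewrite inE connect0 gdistxx.
have AF' : A \notin F' by rewrite inE AF -setI_eq0 setIid.
have [||||M /andP[MF tM] le] := IH F'.
- by move=> B BF; apply: bF; exact: (subsetP sF).
- by move=> B C BF CF; apply: aF; exact: (subsetP sF).
- split=> [B BF|v]; first by apply: fF.1; exact: (subsetP sF).
  apply: le_trans (fF.2 v); rewrite big_mkcond [X in _ <= X]big_mkcond /=.
  apply: ler_sum => B _; case: (boolP (B \in F')) => [/(subsetP sF)->//|_] /=.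
  by case: ifP => // /andP[BF _]; exact: fF.1.
- rewrite -ltnS; apply: leq_trans leF; rewrite ltnS; apply: proper_card.
  by rewrite properE sF; apply/subsetPn; exists A.
have AMF : (A |: M \subset F) && trivIset (A |: M).
  apply/andP; split.
  - by rewrite subUset sub1set AF (subset_trans MF).
  - apply/trivIsetP => B C; rewrite !in_setU1.
    have dA D : D \in M -> [disjoint A & D] by move=> /(subsetP MF); rewrite inE => /andP[].
    case/orP=> [/eqP->|BM] /orP[/eqP->|CM]; rewrite ?eqxx // => BC.
    + exact: dA.
    + by rewrite disjoint_sym dA.
    + by move/trivIsetP: tM; apply.
exists (A |: M) => //.
have AM : A \notin M by apply: contra AF'; exact: (subsetP MF).
rewrite cardsU1 AM natrD mulrDr mulr1.
rewrite (bigID (fun B : {set G} => ~~ [disjoint A & B])) /=; apply: lerD; first exact: light.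
by rewrite (eq_bigl (mem F')) // => B; rewrite !inE negbK.
Qed.

Lemma minimal_member (H : {set {set G}}) (A : {set G}) : A \in H ->
  exists2 B : {set G}, B \subset A &
    (B \in H) && [forall (C : {set G} | C \in H), (C \subset B) ==> (C == B)].
Proof.
move=> AH; pose P := [pred B : {set G} | (B \in H) && (B \subset A)].
have PA : P A by rewrite /= AH subxx.
case: (arg_minnP (fun B : {set G} => #|B|) PA) => B /andP[BH BA] min.
exists B => //; rewrite BH; apply/forall_inP => C CH; apply/implyP => CB.
by rewrite eqEcard CB min //= CH (subset_trans CB).
Qed.

(** The weight of each ball is moved to an inclusion-minimal ball inside it. This increases the load
    of no vertex, and the minimal balls form an antichain. *)
Lemma packing_bound (H : {set {set G}}) : ball_hypergraph H ->
  fractional_matching_number R H <= K * (matching_number H)%:R.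
Proof.
move=> bH; apply: ge_sup.
  exists 0, (fun=> 0); split; last by rewrite big1.
  by split=> // v; rewrite big1.
move=> _ [w [[w0 w1] ->]].
pose F := [set B in H | [forall (C : {set G} | C \in H), (C \subset B) ==> (C == B)]].
have /all_sig[g hg] : forall A : {set G}, {B : {set G} | A \in H -> B \subset A /\ B \in F}.
  move=> A; apply: cid; have [/minimal_member[B BA BF]|] := boolP (A \in H); last by exists A.
  by exists B => _; split=> //; rewrite inE.
have sF : F \subset H by apply/subsetP => B; rewrite inE => /andP[].
pose w' B := \sum_(A in H | g A == B) w A.
have [||//|M /andP[MF tM] le] := @packing_antichain F w'.
- by move=> B BF; apply: bH; exact: (subsetP sF).
- move=> A B AF; rewrite inE => /andP[_ /forall_inP/(_ A (subsetP sF _ AF)) /implyP h] AB.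
  exact/eqP/h.
- split=> [B _|v]; first by apply: sumr_ge0 => A /andP[AH _]; exact: w0.
  apply: le_trans (w1 v); rewrite /w'.
  rewrite (exchange_big_dep (mem H)) /=; last by move=> B A _ /andP[].
  rewrite [X in _ <= X]big_mkcondr /=; apply: ler_sum => A AH; have [gA gF] := hg A AH.
  have [vg|vg] := boolP (v \in g A).
    rewrite (subsetP gA) // (big_pred1 (g A)) // => B.
    rewrite AH /= eq_sym; case: eqP => [->|]; rewrite ?andbF // gF vg.
    by [].
  rewrite big1; first by case: ifP => // _; exact: w0.
  by move=> B /andP[/andP[_ vB] /andP[_ /eqP e]]; rewrite e vB in vg.
have <- : \sum_(B in F) w' B = \sum_(A in H) w A.
  rewrite [RHS](partition_big g (mem F)) //= => A AH.
  by have [] := hg A AH.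
apply: le_trans le _; rewrite ler_wpM2l //.
  rewrite /K mulr_ge0 ?expR_ge0 // (le_trans ler01) //.
  exact: max_minor_avg_degree_ge1.
rewrite ler_nat /matching_number.
by apply: (@leq_bigmax_cond _ _ (fun M : {set {set G}} => #|M|)); rewrite (subset_trans MF).
Qed.
End Packing.

(** * Average degrees of minors *)

Section Bounds.
Variable R : realType.
Local Open Scope ring_scope.

(** Without edges all balls are singletons, so [H] is itself a matching. This complements
    [packing_bound], which assumes an edge. *)
Lemma edgeless_packing (G : sgraph) (H : {set {set G}}) :
  edges G = set0 -> ball_hypergraph H ->
  fractional_matching_number R H <= (matching_number H)%:R.
Proof.
move=> E0 bH.
have singleton A : A \in H -> exists v, A = [set v].
  move=> /bH[r [v ->]]; exists v; apply/setP => u; rewrite !inE.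
  apply/andP/eqP => [[uv _]|->]; last by rewrite connect0 gdistxx.
  apply/esym; apply: (connect_ind (P := fun v => v = u) _ _ uv) => // x y _ xy.
  suff : [set x; y] \in edges G by rewrite E0 inE.
  by rewrite inE; apply/existsP; exists x; apply/existsP; exists y; rewrite xy /=.
have tH : trivIset H.
  apply/trivIsetP => A B /singleton[a ->] /singleton[b ->].
  by rewrite disjoints1 inE; apply: contraNN => /eqP->.
apply: ge_sup.
  exists 0, (fun=> 0); split; last by rewrite big1.
  by split=> // v; rewrite big1.
move=> _ [w [[w0 w1] ->]]; apply: (@le_trans _ _ #|H|%:R).
  rewrite -sum1_card natr_sum; apply: ler_sum => A AH.
  have [a eA] := singleton A AH; apply: le_trans (w1 a).
  rewrite (bigD1 A) ?AH ?eA ?set11 //= lerDl.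
  by apply: sumr_ge0 => B /andP[/andP[BH _] _]; exact: w0.
rewrite ler_nat /matching_number.
by apply: (@leq_bigmax_cond _ _ (fun M : {set {set G}} => #|M|)); rewrite subxx.
Qed.

Lemma avg_degree_le (G : sgraph) (b : nat) :
  ((0 < #|G|)%N -> (#|edges G| <= b * #|G|)%N) -> avg_degree R G <= 2 * b%:R.
Proof.
move=> h; rewrite /avg_degree; have [->|G0] := posnP #|G|.
  by rewrite invr0 mulr0 mulr_ge0.
by rewrite ler_pdivrMr ?ltr0n // -natrM -natrM ler_nat -mulnA leq_mul2l h.
Qed.

Lemma planar_avg_degree (G : sgraph) : planar R G -> max_minor_avg_degree R G <= 6.
Proof.
move=> pG; apply: max_minor_avg_degree_le => M MG.
apply: le_trans (@avg_degree_le M 3 _) _; last by lra.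
move=> M0; rewrite leqNgt; apply/negP => lt.
apply: (planar_no_K5_minor pG); apply: minor_trans MG.
by apply: K5_minor => //; lia.
Qed.

(** From [expR (- (1 / 2)) >= 1 / 2] it follows that [expR (1 / 2) <= 2]. *)
Lemma ln2_ge : 1 / 2 <= ln 2 :> R.
Proof.
rewrite -ler_expR lnK ?posrE //.
have := expR_ge1Dx (- (1 / 2) : R); rewrite expRN => h.
have e0 := expR_gt0 (1 / 2 : R).
have : (1 + - (1 / 2)) * expR (1 / 2) <= 1 :> R.
  by rewrite -ler_pdivlMr // [X in _ <= X]mul1r.
by lra.
Qed.

Lemma sqrt_ln_ge (t : nat) : (1 < t)%N -> 1 / 2 <= Num.sqrt (ln t%:R) :> R.
Proof.
move=> t1; have lnt : 1 / 2 <= ln (t%:R : R).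
  by apply: le_trans ln2_ge _; rewrite ler_ln ?posrE // ?ltr0n ?ler_nat // ltnW.
have : Num.sqrt (ln t%:R) ^+ 2 = ln t%:R :> R by rewrite sqr_sqrtr //; lra.
by have := sqrtr_ge0 (ln t%:R : R); nra.
Qed.

(** Since 3^5 * 4 = 972 is less than 4^5 = 1024, a factor [4 ^ (20 * (r * r))] can be spared, and
    [1 + r * r + 20 * r <= 40 * (r * r)]. *)
Lemma sample_size_ok (r t : nat) : (0 < r)%N -> (t <= 2 ^ (r * r))%N ->
  (2 * t * 4 ^ (10 * r) * 3 ^ ((10 * r) * (10 * r)) <= 4 ^ ((10 * r) * (10 * r)))%N.
Proof.
move=> r0 tr; have -> : (10 * r * (10 * r) = 100 * (r * r))%N by lia.
have p34 : (3 ^ (100 * (r * r)) * 4 ^ (20 * (r * r)) <= 4 ^ (100 * (r * r)))%N.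
  have rr0 : (0 < r * r)%N by rewrite muln_gt0 r0.
  have e100 a : (a ^ 100 = (a ^ 5) ^ 20)%N by rewrite -expnM.
  rewrite (expnM 3 100) (expnM 4 20) (expnM 4 100) -expnMn (leq_exp2r _ _ rr0).
  by rewrite (e100 3) (e100 4) -expnMn leq_exp2r.
apply: leq_trans p34; rewrite mulnC leq_mul2l; apply/orP; right.
rewrite (_ : 4 = (2 ^ 2))%N // -!expnM.
apply: (@leq_trans (2 * 2 ^ (r * r) * 2 ^ (2 * (10 * r))))%N.
  by rewrite leq_mul2r leq_mul2l tr !orbT.
rewrite -expnS -expnD leq_exp2l //.
have : (r <= r * r)%N by rewrite leq_pmulr.
have : (1 <= r * r)%N by rewrite muln_gt0 r0.
by move: (r * r)%N; lia.
Qed.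

(** The integer [r] lies between [2 * x] and [4 * x]: the lower bound gives [t <= 2 ^ (r * r)], the
    upper one the constant 17600 = 2 * 220 * 10 * 4. *)
Lemma no_complete_minor_avg_degree (G : sgraph) (t : nat) : (1 < t)%N ->
  ~ minor (complete t) G ->
  max_minor_avg_degree R G <= 17600 * (t%:R * Num.sqrt (ln t%:R)).
Proof.
move=> t1 nG; set x := Num.sqrt (ln t%:R).
have t0 : 0 < t%:R :> R by rewrite ltr0n ltnW.
have xh : 1 / 2 <= x by exact: sqrt_ln_ge.
have x2 : x ^+ 2 = ln t%:R by rewrite sqr_sqrtr // ln_ge0 // ler1n ltnW.
pose r := (Num.truncn (2 * x)).+1.
have /andP[rl rg] : (Num.truncn (2 * x))%:R <= 2 * x < r%:R.
  by apply: Num.Theory.truncn_itv; lra.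
have rx : r%:R <= 4 * x by rewrite /r -natr1; lra.
have tr : (t <= 2 ^ (r * r))%N.
  rewrite -(ler_nat R) natrX -ler_ln ?posrE ?exprn_gt0 // lnXn //.
  rewrite -[X in _ <= X]mulr_natr natrM -x2.
  have rr : 4 * x ^+ 2 <= r%:R * r%:R.
    have -> : 4 * x ^+ 2 = (2 * x) * (2 * x) by ring.
    by apply: ler_pM; lra.
  apply: (@le_trans _ _ (1 / 2 * (r%:R * r%:R))).
    by have := sqr_ge0 x; lra.
  by rewrite ler_wpM2r ?ln2_ge // mulr_ge0.
have ok := sample_size_ok (isT : (0 < r)%N) tr.
apply: max_minor_avg_degree_le => M MG.
apply: le_trans (@avg_degree_le M (220 * (10 * r * t)) _) _.
  move=> M0; rewrite leqNgt; apply/negP => lt; apply: nG; apply: minor_trans MG.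
  by apply: (@dense_complete_minor M (10 * r) t) => //; exact: ltnW.
rewrite !natrM; have : t%:R * r%:R <= t%:R * (4 * x) by rewrite ler_wpM2l // ltW.
by lra.
Qed.
End Bounds.

Local Open Scope ring_scope.

Theorem theorem1p4 (R : realType) :
  (forall (G : sgraph) (H : {set {set G}}),
     edges G != finset.set0 -> ball_hypergraph H ->
     fractional_matching_number R H
       <= expR 1 * max_minor_avg_degree R G * (matching_number H)%:R)
  /\
  (forall (G : sgraph) (H : {set {set G}}),
     planar R G -> ball_hypergraph H ->
     fractional_matching_number R H
       <= 6 * expR 1 * (matching_number H)%:R)
  /\
  (exists c : R, 0 < c /\
     forall (t : nat) (G : sgraph) (H : {set {set G}}),
       ~ minor (complete t) G -> ball_hypergraph H ->
       fractional_matching_number R H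
         <= c * (t%:R * Num.sqrt (ln t%:R)) * (matching_number H)%:R).
Proof.
have e0 : 0 < expR 1 :> R := expR_gt0 1.
have e1 : 1 < expR 1 :> R by rewrite expR_gt1.
split; first by move=> G H E0 bH; exact: packing_bound.
split.
  move=> G H pG bH; have [E0|E0] := eqVneq (edges G) set0.
    by apply: le_trans (edgeless_packing R E0 bH) _; rewrite ler_peMl //; lra.
  apply: le_trans (packing_bound R E0 bH) _; rewrite ler_wpM2r //.
  by have := planar_avg_degree pG; nra.
exists (expR 1 * 17600); split=> [|t G H nG bH]; first by lra.
(* [complete 0] is a minor of every graph. If [complete 1] is not a minor, there is no vertex, and
   both sides are 0. *)
case: t nG => [|[|t]] nG.
- case: nG; exists (fun=> set0); split=> [[]//|[]//|[]//].
- have noG (v : G) : False.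
    by apply: nG; apply: (minor_inj (f := fun=> v)) => x y; rewrite ?(ord1 x) ?(ord1 y).
  have E0 : edges G = set0.
    by apply/setP => A; rewrite !inE; apply/negbTE/existsP => -[v]; case: (noG v).
  rewrite ln1 sqrtr0 !mulr0 mul0r; apply: le_trans (edgeless_packing R E0 bH) _.
  rewrite lern0 /matching_number -leqn0; apply/bigmax_leqP => M /andP[MH _].
  rewrite leqn0 cards_eq0; apply/eqP/setP => A; rewrite inE; apply/negP => AM.
  by have [_ [v _]] := bH A (subsetP MH A AM); case: (noG v).
have [E0|E0] := eqVneq (edges G) set0.
  apply: le_trans (edgeless_packing R E0 bH) _; rewrite ler_peMl //.
  have := sqrt_ln_ge R (isT : (1 < t.+2)%N); have : 2 <= t.+2%:R :> R by rewrite ler_nat.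
  (* The factor [t * sqrt (ln t)] is at least 1, so the constant covers the edgeless case. *)
  move=> t2 lt; have : 2 * (1 / 2) <= t.+2%:R * Num.sqrt (ln t.+2%:R) :> R.
    by apply: ler_pM => //; lra.
  by move=> h; rewrite mulr_ege1 //; lra.
apply: le_trans (packing_bound R E0 bH) _; rewrite ler_wpM2r // -mulrA ler_pM2l //.
exact: no_complete_minor_avg_degree.
Qed.
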